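(* (i) For every $\varepsilon>0$ there is a constant $C_\varepsilon$ such that every set of $n$ points in $\mathbb{R}^3$ spans at most $C_\varepsilon n^{7/3+\varepsilon}$ triangles whose area equals the maximum area among all triangles spanned by the set. (ii) There is an absolute constant $c>0$ such that for all $n\ge 3$ there exists a set of $n$ points in $\mathbb{R}^3$ spanning at least $c\,n^{4/3}$ triangles of maximum area.
   Context: A triangle spanned by a point set is an unordered triple of its points.
   Formalization: Triangles are required to be non-degenerate (three points not on a line): otherwise n collinear points span about n^3/6 triples, all of the maximum area 0, and (i) fails; for sets not contained in a line the maximum-area triples are unchanged. *)

(* Defs.v *)
From HB Require Import structures.
From mathcomp Require Import all_boot all_order all_algebra finmap ring.
From mathcomp Require Import all_classical all_reals all_analysis.

Set Implicit Arguments.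
Unset Strict Implicit.
Unset Printing Implicit Defensive.
Import Order.TTheory GRing.Theory Num.Theory.
Local Open Scope fset_scope.
Local Open Scope ring_scope.

(* Index arithmetic takes place in 'I_3, i.e. modulo 3. *)
Definition crossmul (R : realType) (u v : 'rV[R]_3) : 'rV[R]_3 :=
  \row_(k < 3) (u 0 (k + 1) * v 0 (k + 2) - u 0 (k + 2) * v 0 (k + 1)).

(* The library norm `|u| on row vectors is the sup norm, not this one. *)
Definition norm2 (R : realType) (u : 'rV[R]_3) : R :=
  Num.sqrt (\sum_i u 0 i ^+ 2).

Definition area (R : realType) (a b c : 'rV[R]_3) : R :=
  norm2 (crossmul (b - a) (c - a)) / 2.

Definition collinear (R : realType) (T : {fset 'rV[R]_3}) : Prop :=
  exists p v : 'rV[R]_3, forall x, x \in T -> exists t : R, x = p + t *: v.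

(* Triangles are nondegenerate: if collinear triples were kept, all of the
   ~ n^3 / 6 triples of a collinear n-point set would have the maximum area 0.
   For a point set not contained in a line the maximum area is positive, so
   keeping them would not change which triples have maximum area. *)
Definition triangles (R : realType) (P : {fset 'rV[R]_3}) :
    {fset {fset 'rV[R]_3}} :=
  [fset T in fpowerset P | (#|` T| == 3%N) && ~~ `[< collinear T >]].

(* [area] is symmetric, so the order in which the vertices are listed is
   irrelevant; see [tri_areaE]. *)
Definition tri_area (R : realType) (T : {fset 'rV[R]_3}) : R :=
  let s := enum_fset T in area s`_0 s`_1 s`_2.

Definition max_area_triangles (R : realType) (P : {fset 'rV[R]_3}) :
    {fset {fset 'rV[R]_3}} :=
  [fset T in triangles P |
    `[< forall T', T' \in triangles P -> tri_area T' <= tri_area T >]].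

Lemma area_swap23 (R : realType) (a b c : 'rV[R]_3) : area a b c = area a c b.
Proof.
rewrite /area /norm2; congr (Num.sqrt _ / 2); apply: eq_bigr => i _.
by rewrite !mxE; ring.
Qed.

Lemma area_swap12 (R : realType) (a b c : 'rV[R]_3) : area a b c = area b a c.
Proof.
rewrite /area /norm2; congr (Num.sqrt _ / 2); apply: eq_bigr => i _.
by rewrite !mxE; ring.
Qed.

Lemma tri_areaE (R : realType) (a b c : 'rV[R]_3) :
  uniq [:: a; b; c] -> tri_area [fset a; b; c] = area a b c.
Proof.
move=> u3; rewrite /tri_area; set s := enum_fset _.
have : perm_eq s [:: a; b; c].
  apply: uniq_perm => //; first exact: fset_uniq.
  by move=> x; rewrite /s -[x \in enum_fset _]/(x \in [fset a; b; c]) !inE orbA.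
have su : uniq s by exact: fset_uniq.
move: s su => s su ps; have := perm_size ps; have := perm_mem ps.
case: s su {ps} => [|x [|y [|z []]]] //= su mem _.
have := mem x; have := mem y; have := mem z.
rewrite !inE !eqxx !orbT /=.
move: su u3; rewrite !inE !negb_or !andbT.
move=> /andP[/andP[xy xz] yz] _.
move=> /esym/or3P[]/eqP ez /esym/or3P[]/eqP ey /esym/or3P[]/eqP ex; subst x y z;
  try by [move: xy; rewrite eqxx | move: xz; rewrite eqxx
         | move: yz; rewrite eqxx].
- by rewrite area_swap23 area_swap12 area_swap23.
- by rewrite area_swap23 area_swap12.
- by rewrite area_swap12 area_swap23.
- by rewrite area_swap23.
- by rewrite area_swap12.
- by [].
Qed.

(* Main.v *)
Require Import Defs.
From HB Require Import structures.
From mathcomp Require Import all_boot all_order all_algebra finmap.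
From mathcomp Require Import all_classical all_reals all_analysis.
From mathcomp Require Import ring lra zify.

Set Implicit Arguments.
Unset Strict Implicit.
Unset Printing Implicit Defensive.
Import Order.TTheory GRing.Theory Num.Theory.
Local Open Scope fset_scope.
Local Open Scope ring_scope.

(** Upper bound. Fix a vertex [a] and write [x = p - a]. The pairs [(x, u)]
    spanning a triangle of maximum area with [a] are the incidences between
    points [x] and cylinders with axis [u] through the origin, all points being
    inside all cylinders. On the cylinder of [u0] the other cylinders cut out,
    on each generating line, an interval; so the part of that cylinder on the
    boundary of the common intersection lies between an upper and a lower
    envelope of curves meeting pairwise boundedly often, and Davenport-Schinzel
    bounds make each of these envelopes of almost linear complexity. This
    gives almost [n^2] pairs of incidences sharing a point, hence, for [X]
    points and [U] cylinders, [I <= C (|U| + sqrt |U| |X|^(1 + eps))].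
    Hitting all large conflict lists by a sample of about [n^(1/3)] cylinders
    splits the points into about [n^(2/3)] cells, each met by at most
    [n^(2/3)] cylinders, and summing the previous bound over the cells yields
    [n^(4/3 + eps)] incidences for each [a].

    Lower bound. Take the origin and unit vectors clustered around the first
    two coordinate axes; a triangle has area at most [1/2], with equality when
    it joins the origin to two orthogonal vectors. Orthogonality encodes
    point-line incidences, and a grid provides [n^(4/3)] of them. *)

(** * Words with few alternations *)

(** Comparisons between cylinders are made in the homogeneous form [nn x u <= nn x u0], which
    depends only on the line spanned by [x]. One sweep around [u0] thus serves the points on the
    cylinder of [u0] and, by radial projection, those strictly inside. A point is given to the
    sampled [u0] with the largest [nn x u0]; if it is off that cylinder, every cylinder through it
    beats [u0] there and so lies in the conflict list of its cell.

    The cells depend on the sample, so the sample cannot be chosen to hit their lists directly. But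
    a cell is described by three axes and a slice of a sweep order: there are at most [4 * n ^ 5]
    descriptions, fixed beforehand, and a greedy choice hits all those with long lists.

    The envelopes become words whose letters are cylinders. Points where two cylinders both touch
    that of [u0] would spoil the count of alternations, since their letters come in arbitrary order;
    an argument on pencils of conics leaves at most four such points per pair.

    With sample size [s] near [n^(1/3)] and lists of length [t = n^(2/3)], the costs [s n], [s^2 t]
    and [sqrt t n] all balance at [n^(4/3)]. *)

Section Changes.
Local Open Scope nat_scope.
Variable T : eqType.
Implicit Types (s W : seq T) (P : pred T).

Fixpoint chg s : nat :=
  if s is x :: s' then (if s' is y :: _ then x != y : nat else 0) + chg s'
  else 0.

(** The Davenport-Schinzel condition of order [K], with adjacent repetitions allowed. Counting
    changes instead of letters makes it pass to subwords. *)
Definition pairchg K W := forall a b, chg [seq x <- W | pred2 a b x] <= K.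

Lemma chg_cons2 x y s : chg [:: x, y & s] = (x != y) + chg (y :: s).
Proof. by []. Qed.

Lemma chg_cat_le s1 s2 : chg (s1 ++ s2) <= chg s1 + chg s2 + 1.
Proof.
elim: s1 => [|x [|y s1] IH] //=; first by rewrite add0n leq_addr.
  by case: s2 {IH} => [|z s2] //=; case: (_ != _); lia.
by move: IH; rewrite cat_cons /=; lia.
Qed.

Lemma chg_cat_ge s1 s2 : chg s1 + chg s2 <= chg (s1 ++ s2).
Proof.
elim: s1 => [|x [|y s1] IH] //=; first by rewrite leq_addl.
by move: IH; rewrite cat_cons /=; lia.
Qed.

Lemma chg_rcons_cat s z s2 :
  chg (rcons s z ++ s2) = chg (rcons s z) + chg (z :: s2).
Proof.
elim: s => [|x [|y s] IH] //=; first by rewrite !addn0.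
by move: IH => /= ->; rewrite !addnA.
Qed.

Lemma chg_neq_head x s y : y \in s -> x != y -> 0 < chg (x :: s).
Proof.
elim: s x => // z s IH x; rewrite inE chg_cons2 => /predU1P[->|ys] xy.
  by rewrite xy.
have [<-|//] := eqVneq x z.
by rewrite add0n IH.
Qed.

(** Whichever of [x], [y] ends the prefix, the other one still occurs in [s2]. *)
Lemma chg_cat_gtl s1 s2 x y : x != y -> x \in s2 -> y \in s2 ->
  {subset s1 <= [:: x; y]} -> s1 != [::] -> chg s1 < chg (s1 ++ s2).
Proof.
move=> xy xs ys; case/lastP: s1 => // s z sub _.
rewrite chg_rcons_cat -[X in X < _]addn0 ltn_add2l.
have := sub z; rewrite mem_rcons inE eqxx => /(_ isT).
rewrite !inE => /orP[]/eqP ->; first exact: chg_neq_head ys xy.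
by apply: chg_neq_head xs _; rewrite eq_sym.
Qed.

Lemma chg_const z s : all (pred1 z) s -> chg s = 0.
Proof.
elim: s => // x [|y s] IH // /andP[/eqP xz H]; rewrite chg_cons2 (IH H) addn0 xz.
by have /andP[/eqP -> _] := H; rewrite eqxx.
Qed.

Lemma chg_rev s : chg (rev s) = chg s.
Proof.
elim: s => [|x [|y s] IH] //.
rewrite rev_cons -cats1 rev_cons chg_rcons_cat -rev_cons IH chg_cons2 /=.
by rewrite !addn0 addnC eq_sym.
Qed.

Lemma pairchg_infix K s1 s2 s3 : pairchg K (s1 ++ s2 ++ s3) -> pairchg K s2.
Proof.
move=> H a b; apply: leq_trans (H a b); rewrite !filter_cat.
have := chg_cat_ge [seq x <- s1 | pred2 a b x]
  ([seq x <- s2 | pred2 a b x] ++ [seq x <- s3 | pred2 a b x]).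
have := chg_cat_ge [seq x <- s2 | pred2 a b x] [seq x <- s3 | pred2 a b x].
lia.
Qed.

Lemma pairchg_filter K P W : pairchg K W -> pairchg K (seq.filter P W).
Proof.
move=> H a b; rewrite -filter_predI.
have [Pa|Pa] := boolP (P a); have [Pb|Pb] := boolP (P b).
- rewrite (_ : [seq x <- W | _] = [seq x <- W | pred2 a b x]) //.
  by apply: eq_filter => x /=; case: eqP => [->|]; case: eqP => [->|]; rewrite ?Pa ?Pb.
- apply: leq_trans (H a a).
  rewrite (_ : [seq x <- W | _] = [seq x <- W | pred2 a a x]) //.
  apply: eq_filter => x /=; case: eqP => [->|]; rewrite ?Pa //.
  by case: eqP => [->|]; rewrite ?(negbTE Pb).
- apply: leq_trans (H b b).
  rewrite (_ : [seq x <- W | _] = [seq x <- W | pred2 b b x]) //.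
  apply: eq_filter => x /=; case: (x =P b) => [->|]; rewrite ?Pb ?orbT //.
  by case: eqP => [->|]; rewrite ?(negbTE Pa).
- rewrite (_ : [seq x <- W | _] = [::]) //.
  rewrite -(filter_pred0 W); apply: eq_filter => x /=.
  by case: eqP => [->|]; case: eqP => [->|]; rewrite ?(negbTE Pa) ?(negbTE Pb).
Qed.

Lemma pairchg0 W : pairchg 0 W -> chg W = 0.
Proof.
elim: W => [|x [|y W] IH] // H; rewrite chg_cons2 IH ?addn0.
  by have := H x y; rewrite /= !eqxx orbT /=; case: (x =P y).
by apply: (@pairchg_infix _ [:: x] _ [::]); rewrite cats0.
Qed.

Lemma split_prefix (Q : pred T) W :
  exists V W', [/\ W = V ++ W', all Q V & if W' is c :: _ then ~~ Q c else true].
Proof.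
elim: W => [|x W [V [W' [-> aV hW]]]]; first by exists [::], [::].
have [Qx|Qx] := boolP (Q x); first by exists (x :: V), W'; rewrite /= Qx.
by exists [::], (x :: V ++ W').
Qed.

Lemma chg_nseq_head s1 x s2 : all (pred1 x) s1 -> s1 != [::] ->
  (if s2 is c :: _ then c != x else false) -> chg (s1 ++ s2) = (chg s2).+1.
Proof.
elim: s1 => // y [|z s1] IH /=; rewrite ?andbT.
  by move/eqP-> => _; case: s2 {IH} => // c s2; rewrite eq_sym => ->.
case/andP=> /eqP -> H _ h2; have /andP[/eqP zx _] := H.
by have /= -> := IH H isT h2; rewrite zx eqxx.
Qed.

(* Cut W greedily into segments using at most one letter of P and at most one
   letter outside P: every cut is paid for by a change in one of the two
   subwords. *)
Lemma chg_merge K P W : pairchg K W ->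
  chg W <= K.+1 * (chg (seq.filter P W) + chg (seq.filter (predC P) W) + 1).
Proof.
have [m] := ubnP (size W); elim: m W => // m IH W szW HK.
have [Wn|Wn] := eqVneq (seq.filter P W) [::].
  rewrite (_ : seq.filter (predC P) W = W) ?Wn; first by rewrite mulSn; lia.
  apply/all_filterP; rewrite all_predC has_filter; exact/negPn/eqP.
have [Wn'|Wn'] := eqVneq (seq.filter (predC P) W) [::].
  rewrite Wn' (_ : seq.filter P W = W); first by rewrite mulSn; lia.
  apply/all_filterP; rewrite -[P]/(P : pred T).
  have := has_filter (predC P) W; rewrite Wn' /= => /negbT.
  by rewrite has_predC negbK.
case eP: (seq.filter P W) Wn => [//|a sa] _.
case eC: (seq.filter (predC P) W) Wn' => [//|b sb] _.
have aP : P a by have := mem_filter P a W; rewrite eP mem_head => /esym/andP[].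
have bP : ~~ P b.
  by have := mem_filter (predC P) b W; rewrite eC mem_head => /esym/andP[].
have [V [W' [eW aV hW']]] := split_prefix (pred2 a b) W.
have chV : chg V <= K.
  apply: leq_trans (HK a b); rewrite eW filter_cat.
  rewrite (_ : [seq x <- V | _] = V); last exact/all_filterP.
  by have := chg_cat_ge V [seq x <- W' | pred2 a b x]; lia.
case eW': W' hW' => [|c W''] hc; first by rewrite eW eW' cats0 mulSn; lia.
have fV : all (pred1 a) (seq.filter P V).
  apply/allP => x; rewrite mem_filter => /andP[Px xV].
  have := allP aV _ xV; rewrite /= => /orP[//|/eqP xb].
  by rewrite xb (negbTE bP) in Px.
have fV' : all (pred1 b) (seq.filter (predC P) V).
  apply/allP => x; rewrite mem_filter => /andP[Px xV].
  have := allP aV _ xV; rewrite /= => /orP[/eqP xa|//].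
  by rewrite /= xa aP in Px.
have {}IH : chg W' <= K.+1 * (chg (seq.filter P W') + chg (seq.filter (predC P) W') + 1).
  apply: IH.
    move: szW; rewrite eW size_cat; case: V eW {aV chV fV fV'} => [|v V] eW /=.
      exfalso; move: hc; rewrite negb_or => /andP[ca cb].
      move: eP eC; rewrite eW eW' /=; case: (P c) => /=.
        by case=> ca' _; rewrite ca' eqxx in ca.
      by move=> _ [cb' _]; rewrite cb' eqxx in cb.
    lia.
  by move: HK; rewrite eW -[V ++ W'](cats0 (V ++ W')) -catA; apply: pairchg_infix.
have step : chg (seq.filter P W') + chg (seq.filter (predC P) W') + 1 <=
            chg (seq.filter P W) + chg (seq.filter (predC P) W).
  rewrite eW !filter_cat; move: hc; rewrite negb_or => /andP[ca cb].
  have [Pc|Pc] := boolP (P c).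
    have Vn : seq.filter P V != [::].
      apply/eqP => Vn; move: eP; rewrite eW filter_cat Vn eW' /= Pc => -[ca' _].
      by rewrite ca' eqxx in ca.
    rewrite (chg_nseq_head fV Vn) ?eW' /= ?Pc //=.
    have := chg_cat_ge (seq.filter (predC P) V) (seq.filter (predC P) (c :: W'')).
    rewrite /= Pc /=; lia.
  have Vn : seq.filter (predC P) V != [::].
    apply/eqP => Vn; move: eC; rewrite eW filter_cat Vn eW' /= Pc => -[cb' _].
    by rewrite cb' eqxx in cb.
  rewrite (chg_nseq_head fV' Vn) ?eW' /= ?Pc //=.
  have := chg_cat_ge (seq.filter P V) (seq.filter P (c :: W'')).
  rewrite /= (negbTE Pc) /=; lia.
have := chg_cat_le V W'; rewrite -eW -eP -eC.
move: IH step chV; set p := chg (seq.filter P W) + _; set q := chg (seq.filter P W') + _.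
nia.
Qed.

Lemma chg_take_exists s k : k <= chg s -> exists i, chg (take i s) = k.
Proof.
move=> kc; have ex : exists i, k <= chg (take i s).
  by exists (size s); rewrite take_size.
case: (ex_minnP ex) => i Hi mini; exists i; apply/eqP; rewrite eqn_leq Hi andbT.
case: i Hi mini => [|i] Hi mini; first by rewrite take0.
have lt : chg (take i s) < k by rewrite ltnNge; apply/negP => /mini; rewrite ltnn.
have [si|si] := leqP (size s) i.
  by rewrite (take_oversize (leqW si)) -(take_oversize si) ltnW.
case: s si {ex kc} Hi mini lt => // x0 s si _ _ lt.
rewrite (take_nth x0) //; move: (nth _ _ _) => z.
suff: chg (rcons (take i (x0 :: s)) z) <= (chg (take i (x0 :: s))).+1.
  by move/leq_trans; apply.
by rewrite -cats1; apply: leq_trans (chg_cat_le _ _) _; rewrite /= !addn0 addn1.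
Qed.

Lemma chg_halve s : exists s1 s2,
  [/\ s = s1 ++ s2, chg s + 2 <= 2 * (chg s1 + 2) & chg s + 2 <= 2 * (chg s2 + 2)].
Proof.
have [|i Hi] := @chg_take_exists s (chg s)./2; first by lia.
exists (take i s), (drop i s); rewrite cat_take_drop.
have := chg_cat_le (take i s) (drop i s); rewrite cat_take_drop Hi.
by split=> //; lia.
Qed.

Definition only_in (A B C : seq T) := [seq x <- B | (x \notin A) && (x \notin C)].

(** Halve [j] times: the letters confined to one half and those confined to the other form disjoint
    sets, so the half with fewer of them is kept. The [+ 2] absorbs the change lost at a cut and the
    rounding. *)
Lemma few_internal j W : exists A B C, [/\ W = A ++ B ++ C,
  chg W + 2 <= 2 ^ j * (chg B + 2) &
  2 ^ j * size (undup (only_in A B C)) <= size (undup W)].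
Proof.
elim: j => [|j [A [B [C [eW cW sW]]]]].
  exists [::], W, [::]; split; rewrite ?cats0 ?expn0 ?mul1n //.
  by rewrite /only_in (eq_filter (a2 := predT)) ?filter_predT.
have [B1 [B2 [eB c1 c2]]] := chg_halve B.
pose I1 := undup (only_in A B1 (B2 ++ C)).
pose I2 := undup (only_in (A ++ B1) B2 C).
have : size I1 + size I2 <= size (undup (only_in A B C)).
  rewrite -size_cat; apply: uniq_leq_size.
    rewrite cat_uniq !undup_uniq /= andbT; apply/hasPn => x.
    rewrite !mem_undup !mem_filter !mem_cat !negb_or => /andP[/andP[/andP[_ xB] _] _].
    by rewrite (negbTE xB) andbF.
  move=> x; rewrite mem_cat !mem_undup !mem_filter eB !mem_cat !negb_or.
  by case/orP=> [/andP[/and3P[-> _ ->] ->]|/andP[/andP[/andP[-> _] ->] ->]] //; rewrite orbT.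
have [le12|le21] := leqP (size I1) (size I2) => sI.
- exists A, B1, (B2 ++ C); split; first by rewrite eW eB -catA.
    by rewrite expnS; nia.
  by rewrite expnS -/I1; nia.
- exists (A ++ B1), B2, C; split; first by rewrite eW eB -!catA.
    by rewrite expnS; nia.
  by rewrite expnS -/I2; nia.
Qed.

(** Two letters of [B] that both recur in [C] produce one more change there, so inside [B] the order
    drops by one. *)
Lemma pairchg_before K A B C : pairchg K.+1 (A ++ B ++ C) ->
  pairchg K [seq x <- B | x \in C].
Proof.
move=> H a b; rewrite -filter_predI.
have [ab|ab] := eqVneq a b.
  rewrite (@chg_const a) //; apply/allP => x.
  by rewrite mem_filter /= ab => /andP[/andP[/orP[]/eqP-> _] _] /=.
set s := seq.filter _ _; have [->//|sn] := eqVneq s [::].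
have sz : {in s, forall z, pred2 a b z /\ z \in C}.
  by move=> z; rewrite mem_filter /= => /andP[/andP[]].
have [aC|aC] := boolP (a \in C); last first.
  rewrite (@chg_const b) //; apply/allP => z /sz[/orP[/eqP ->|//]].
  by rewrite (negbTE aC).
have [bC|bC] := boolP (b \in C); last first.
  rewrite (@chg_const a) //; apply/allP => z /sz[/orP[//|/eqP ->]].
  by rewrite (negbTE bC).
have es : s = [seq x <- B | pred2 a b x].
  by apply: eq_filter => z /=; case: eqP => [->|]; case: eqP => [->|]; rewrite ?aC ?bC.
have fC z : z \in [:: a; b] -> z \in [seq x <- C | pred2 a b x].
  by rewrite !inE mem_filter /= => /orP[]/eqP->; rewrite eqxx ?orbT ?aC ?bC.
have lt : chg s < chg (s ++ [seq x <- C | pred2 a b x]).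
  apply: (chg_cat_gtl ab) => //.
  - by apply: fC; rewrite !inE eqxx.
  - by apply: fC; rewrite !inE eqxx orbT.
  - by move=> z /sz[] /=; rewrite !inE.
rewrite -ltnS; apply: leq_trans (H a b); apply: leq_trans lt _.
rewrite es !filter_cat.
by apply: leq_trans (chg_cat_ge _ _); rewrite leq_addl.
Qed.

Lemma pairchg_rev K W : pairchg K W -> pairchg K (rev W).
Proof. by move=> H a b; rewrite filter_rev chg_rev. Qed.

Lemma pairchg_after K A B C : pairchg K.+1 (A ++ B ++ C) ->
  pairchg K [seq x <- B | x \in A].
Proof.
move=> /pairchg_rev; rewrite !rev_cat -catA => /pairchg_before /pairchg_rev.
rewrite filter_rev revK (eq_filter (a2 := mem A)) // => x.
by rewrite mem_rev.
Qed.

End Changes.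

(** * Almost linear Davenport-Schinzel bounds *)

Section DS.
Variable R : realType.
Implicit Types (eps : R) (n m : nat).

Lemma natpow_ge1 eps n : 0 < eps -> (0 < n)%N -> 1 <= n%:R `^ eps :> R.
Proof.
move=> e0 n0; rewrite [leLHS](_ : 1 = 1 `^ eps); last by rewrite powR1.
by rewrite ge0_ler_powR ?nnegrE ?ler0n ?ler1n // ltW.
Qed.

Lemma ler_natpow eps m n : 0 < eps -> (m <= n)%N -> m%:R `^ eps <= n%:R `^ eps :> R.
Proof. by move=> e0 mn; rewrite ge0_ler_powR ?nnegrE ?ler0n ?ler_nat // ltW. Qed.

Lemma exp2_powR_large eps (y : R) : 0 < eps -> 0 <= y ->
  exists2 j, (0 < j)%N & y <= (2 ^ j)%:R `^ eps.
Proof.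
move=> e0 y0; pose z := y `^ eps^-1.
have z0 : 0 <= z by rewrite powR_ge0.
exists (Num.truncn z).+1 => //.
have zj : z <= (2 ^ (Num.truncn z).+1)%:R.
  have /andP[_ /ltW] := truncn_itv z0; move/le_trans; apply.
  by rewrite ler_nat ltnW // ltn_expl.
have -> : y = z `^ eps by rewrite -powRrM mulVf ?gt_eqF // powRr1.
by rewrite ge0_ler_powR ?nnegrE ?ler0n // ltW.
Qed.

(** Outer induction on the order, inner induction on the alphabet. After [j] halvings the letters
    confined to the middle piece [B] are few and fall under the inner hypothesis; every other letter
    of [B] recurs to its left or right, where the order is lower. Two uses of [chg_merge] glue the
    three subwords. *)
Theorem davenport_schinzel eps K : 0 < eps -> exists2 C : R, 0 <= C &
  forall (T : eqType) (W : seq T), pairchg K W ->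
    (chg W)%:R <= C * (size (undup W))%:R `^ (1 + eps).
Proof.
move=> e0; elim: K => [|K [C0 C00 IHK]].
  by exists 0 => // T W /pairchg0 ->; rewrite mul0r.
pose k : R := K.+2%:R.
have k1 : 1 <= k by rewrite /k ler1n.
(* The exponent [1 + eps] gains [b ^ eps >= 2 * k] when the alphabet shrinks by the factor [b]; this
   pays for the factor [k] of [chg_merge] at order [K.+1] and leaves half of the budget for the
   other letters. *)
have [|j j0 bk] := @exp2_powR_large eps (2 * k) e0; first by lra.
set b : R := (2 ^ j)%:R in bk.
have b0 : 0 < b by rewrite /b ltr0n expn_gt0.
pose D := 2 + k * (k * (2 * C0 + 1) + 1).
have D0 : 0 <= D by rewrite /D; nra.
have e1 : 0 < 1 + eps by lra.
exists (2 * b * D); first by rewrite !mulr_ge0 // ltW.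
move=> T W; have [n] := ubnP (size (undup W)); elim: n W => // n IHn W szW HW.
have [A [B [C [eW cW sW]]]] := few_internal j W.
have [W0|Wn] := eqVneq W [::].
  by rewrite W0 /= powR0 ?mulr0 // gt_eqF.
set N := size (undup W) in szW sW *.
have N0 : (0 < N)%N.
  rewrite lt0n size_eq0; apply/eqP => u0.
  by case: W Wn u0 {eW cW sW HW szW N} => // x W _ u0; have := mem_undup (x :: W) x;
     rewrite u0 mem_head.
have HB : pairchg K.+1 B by move: HW; rewrite eW; apply: pairchg_infix.
pose P x := (x \notin A) && (x \notin C).
have cB := chg_merge P HB.
have cN := chg_merge (mem C) (@pairchg_filter _ _ (predC P) _ HB).
have sub (s : seq T) : {subset s <= W} -> (size (undup s) <= N)%N.
  move=> sW'; apply: uniq_leq_size (undup_uniq _) _ => x.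
  by rewrite !mem_undup; apply: sW'.
have BW : {subset B <= W} by move=> x xB; rewrite eW !mem_cat xB orbT.
have fsub Q : {subset seq.filter Q B <= W}.
  by move=> x; rewrite mem_filter => /andP[_ /BW].
have low s : pairchg K s -> {subset s <= W} ->
    (chg s)%:R <= C0 * N%:R `^ (1 + eps).
  move=> Hs ss; apply: le_trans (IHK _ _ Hs) _.
  by rewrite ler_wpM2l // ler_natpow // sub.
have cl : (chg (seq.filter (mem C) (seq.filter (predC P) B)))%:R <= C0 * N%:R `^ (1 + eps).
  apply: low.
    rewrite -filter_predI (eq_filter (a2 := predI (predC P) (mem C))); last first.
      by move=> x /=; rewrite andbC.
    rewrite filter_predI; apply: pairchg_filter.
    by move: HW; rewrite eW; apply: pairchg_before.
  by move=> x; rewrite mem_filter => /andP[_ /fsub].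
have ce : (chg (seq.filter (predC (mem C)) (seq.filter (predC P) B)))%:R
    <= C0 * N%:R `^ (1 + eps).
  apply: low.
    rewrite -filter_predI (eq_filter (a2 := predI (predC (mem C)) (mem A))); last first.
      by move=> x /=; rewrite /P negb_and !negbK; case: (x \in C); rewrite ?andbF ?orbF.
    rewrite filter_predI; apply: pairchg_filter.
    by move: HW; rewrite eW; apply: pairchg_after.
  by move=> x; rewrite mem_filter => /andP[_ /fsub].
set M := size (undup (only_in A B C)) in sW.
have ltMN : (M < N)%N.
  have : (2 <= 2 ^ j)%N by rewrite -[X in (X <= _)%N]expn1 leq_exp2l.
  by move: sW N0; nia.
have cI : (chg (seq.filter P B))%:R <= 2 * b * D * M%:R `^ (1 + eps).
  apply: IHn; last exact: pairchg_filter.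
  by rewrite -ltnS; apply: leq_trans szW.
set p := N%:R `^ (1 + eps) in cl ce *.
have p1 : 1 <= p by apply: natpow_ge1.
have pM : b * (2 * k) * M%:R `^ (1 + eps) <= p.
  apply: (@le_trans _ _ (b `^ (1 + eps) * M%:R `^ (1 + eps))).
    rewrite ler_wpM2r ?powR_ge0 // powRD ?(gt_eqF b0) ?implybT //.
    by rewrite (powRr1 (ltW b0)) ler_wpM2l // ltW.
  by rewrite -powRM ?ler0n // /b -natrM ler_natpow.
move: cB; rewrite -(ler_nat R) natrM !natrD -/k => cB.
move: cN; rewrite -(ler_nat R) natrM !natrD -/k => cN.
move: cW; rewrite -(ler_nat R) natrM !natrD -/b => cW.
have cN' : (chg (seq.filter (predC P) B))%:R <= k * (2 * C0 + 1) * p.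
  apply: (le_trans cN); rewrite -mulrA ler_wpM2l //; nra.
have cB' : (chg B)%:R <= k * (chg (seq.filter P B))%:R + k * (k * (2 * C0 + 1) + 1) * p.
  apply: (le_trans cB); rewrite -mulrA -mulrDr ler_wpM2l //; nra.
have bkI : b * (k * (chg (seq.filter P B))%:R) <= b * D * p.
  apply: (@le_trans _ _ (b * (k * (2 * b * D * M%:R `^ (1 + eps))))).
    by rewrite !ler_wpM2l // ltW // (lt_le_trans _ k1).
  rewrite (_ : b * _ = b * D * (b * (2 * k) * M%:R `^ (1 + eps))); last by ring.
  by rewrite ler_wpM2l // mulr_ge0 // ltW.
have : b * ((chg B)%:R + 2) <= b * (k * (chg (seq.filter P B))%:R) + b * (D * p).
  rewrite -mulrDr ler_wpM2l //; rewrite /D; nra.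
lra.
Qed.

End DS.

(** * Sign changes of polynomials *)

Lemma chg_map_le (X : Type) (S S1 S2 : eqType) (f : X -> S) (g1 : X -> S1)
    (g2 : X -> S2) (s : seq X) :
  (forall x y, g1 x = g1 y -> g2 x = g2 y -> f x = f y) ->
  (chg (map f s) <= chg (map g1 s) + chg (map g2 s))%N.
Proof.
move=> H; elim: s => [|x [|y s] IH] //; move: IH.
rewrite !map_cons !chg_cons2 -!map_cons => IH.
have : ((f x != f y) <= (g1 x != g1 y) + (g2 x != g2 y))%N.
  have [e1|_] := eqVneq (g1 x) (g1 y); have [e2|_] := eqVneq (g2 x) (g2 y);
    try by case: (f x != f y).
  by rewrite (H x y e1 e2) eqxx.
lia.
Qed.

Lemma chg_map_const (X : Type) (S : eqType) (f : X -> S) (c : S) (s : seq X) :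
  (forall x, f x = c) -> chg (map f s) = 0%N.
Proof. by move=> fc; apply: (@chg_const _ c); elim: s => //= x s ->; rewrite fc eqxx. Qed.

Lemma chg_map_factor (X : Type) (S S1 : eqType) (f : X -> S) (g : X -> S1) (s : seq X) :
  (forall x y, g x = g y -> f x = f y) -> (chg (map f s) <= chg (map g s))%N.
Proof.
move=> H; have := @chg_map_le _ _ _ _ f g (fun _ => tt) s (fun x y e _ => H x y e).
by rewrite (@chg_map_const _ _ _ tt) ?addn0.
Qed.

Section Signs.
Variable R : rcfType.
Implicit Types (p : {poly R}) (ws : seq R).

Lemma chg_sgr_sub (z : R) ws : sorted <=%R ws ->
  (chg [seq Num.sg (w - z) | w <- ws] <= 2)%N.
Proof.
(* The sign is nondecreasing along the word and jumps by at least one, so [1 - sg] bounds the jumps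
   still to come. *)
have key w ws' : path <=%R w ws' ->
    (chg [seq Num.sg (w - z) | w <- w :: ws'])%:R <= 1 - Num.sg (w - z).
  elim: ws' w => [|y s IH] w; first by rewrite /= subr_ge0; case: sgrP => _ //; lra.
  move=> /andP[wy /IH]; rewrite !map_cons chg_cons2 natrD.
  have : Num.sg (w - z) <= Num.sg (y - z).
    by move: wy; case: sgrP => h1; case: sgrP => h2; lra.
  have [->|] := eqVneq (Num.sg (w - z)) (Num.sg (y - z)).
    by rewrite add0r.
  move=> ne le; have : Num.sg (w - z) + 1 <= Num.sg (y - z).
    by move: ne le; case: sgrP => h1; case: sgrP => h2; rewrite ?eqxx //; lra.
  rewrite /=; lra.
case: ws => // w ws /key; rewrite -(ler_nat R) => /le_trans; apply.
by case: sgrP => _; lra.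
Qed.

(** Each real root splits off a linear factor, whose sign changes at most twice (it may pass through
    0); a polynomial without roots keeps its sign by the intermediate value theorem. *)
Lemma chg_sgr_poly p ws : sorted <=%R ws ->
  (chg [seq Num.sg p.[w] | w <- ws] <= 2 * size p)%N.
Proof.
move=> sws; have [n] := ubnP (size p); elim: n p => // n IH p szp.
have [->|p0] := eqVneq p 0.
  rewrite (@chg_const _ 0) //; apply/allP => x /mapP[w _ ->] /=.
  by rewrite horner0 sgr0.
have [[z /factor_theorem[q pq]]|nr] := EM (exists z, root p z).
  have q0 : q != 0 by apply: contraNneq p0 => q0; rewrite pq q0 mul0r.
  have szq : size p = (size q).+1.
    by rewrite pq size_Mmonic ?monicXsubC // size_XsubC addn2.
  have : (chg [seq Num.sg p.[w] | w <- ws] <=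
      chg [seq Num.sg q.[w] | w <- ws] + chg [seq Num.sg (w - z) | w <- ws])%N.
    apply: chg_map_le => x y e1 e2.
    by rewrite pq !hornerM !hornerXsubC !sgrM e1 e2.
  have := IH q; rewrite -ltnS -szq szp => /(_ isT) Hq.
  by move/leq_trans; apply; rewrite szq mulnS addnC leq_add // chg_sgr_sub.
have cst x y : x <= y -> Num.sg p.[x] = Num.sg p.[y].
  move=> xy.
  have nz w : p.[w] != 0 by apply/negP => /eqP h; apply: nr; exists w; apply/rootP.
  have := nz x; have := nz y; case: (sgrP p.[x]); case: (sgrP p.[y]) => //.
  - move=> py px _ _; exfalso.
    have [|w _ rw] := @poly_ivt _ (- p) x y xy.
      by rewrite !hornerN oppr_le0 oppr_ge0 !ltW.
    by apply: nr; exists w; rewrite rootN in rw.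
  - move=> py px _ _; exfalso.
    have [|w _ rw] := @poly_ivt _ p x y xy; first by rewrite !ltW.
    by apply: nr; exists w.
case: ws sws {IH} => // w ws _; rewrite (@chg_const _ (Num.sg p.[w])) //.
apply/allP => x /mapP[y _ ->] /=.
by case: (leP w y) => h; rewrite ?(cst _ _ h) // (cst _ _ (ltW h)).
Qed.

Lemma chg_signs (X : Type) (S : eqType) (w : X -> R) (f : X -> S) (ps : seq {poly R})
    (ys : seq X) :
  sorted <=%R (map w ys) ->
  (forall x y, [seq Num.sg p.[w x] | p <- ps] = [seq Num.sg p.[w y] | p <- ps] ->
     f x = f y) ->
  (chg (map f ys) <= \sum_(p <- ps) 2 * size p)%N.
Proof.
move=> sw Hf; pose g x := [seq Num.sg p.[w x] | p <- ps].
apply: leq_trans (chg_map_factor _ (g := g) Hf) _.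
rewrite {Hf f}/g; elim: ps => [|p ps IH].
  by rewrite (@chg_map_const _ _ _ [::]).
rewrite big_cons /=; apply: leq_trans (leq_add (leqnn _) IH).
have := chg_sgr_poly p sw; rewrite -map_comp => H.
apply: leq_trans (leq_add H (leqnn _)).
by apply: chg_map_le => x y /= -> ->.
Qed.

End Signs.

(** * Sweeping around an axis *)

Section Vectors.
Variable R : rcfType.

(** Triples rather than row vectors: the projections reduce, so [ring] can settle coordinate
    identities. *)
Definition vec : Type := (R * R * R)%type.
Implicit Types (x y u v a b k : vec) (X U : seq vec).

Definition dot x y : R := x.1.1 * y.1.1 + x.1.2 * y.1.2 + x.2 * y.2.

Definition cross x y : vec :=
  (x.1.2 * y.2 - x.2 * y.1.2, x.2 * y.1.1 - x.1.1 * y.2,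
   x.1.1 * y.1.2 - x.1.2 * y.1.1).

Definition lin3 (c d e : R) x y u : vec :=
  (c * x.1.1 + d * y.1.1 + e * u.1.1, c * x.1.2 + d * y.1.2 + e * u.1.2,
   c * x.2 + d * y.2 + e * u.2).

(* Squared area of the parallelogram on [x] and [u], and its polar form in [x]. *)
Definition nn x u : R := dot (cross x u) (cross x u).
Definition bn x y u : R := dot (cross x u) (cross y u).

Lemma dot_ge0 x : 0 <= dot x x.
Proof. by rewrite /dot; nra. Qed.

Lemma nn_ge0 x u : 0 <= nn x u.
Proof. exact: dot_ge0. Qed.

Lemma nnC x u : nn x u = nn u x.
Proof. by rewrite /nn /dot /cross /=; ring. Qed.

Lemma nn_gt0 x u : (0 < nn x u) = (nn x u != 0).
Proof. by rewrite lt_def nn_ge0 andbT. Qed.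

Lemma dot_eq0 x : dot x x = 0 -> [/\ x.1.1 = 0, x.1.2 = 0 & x.2 = 0].
Proof.
rewrite /dot => h; split; apply/eqP; rewrite -sqrf_eq0 expr2;
  apply/eqP; nra.
Qed.

Lemma nn_lin3 c d e x y z u : nn (lin3 c d e x y z) u =
  c ^+ 2 * nn x u + d ^+ 2 * nn y u + e ^+ 2 * nn z u
  + 2 * (c * d * bn x y u + c * e * bn x z u + d * e * bn y z u).
Proof. by rewrite /nn /bn /lin3 /dot /cross /=; ring. Qed.

Lemma nonroot (p : {poly R}) : p != 0 -> exists s, p.[s] != 0.
Proof.
move=> p0; apply/not_existsP => H.
have : (size [seq i%:R : R | i <- iota 0 (size p)] < size p)%N.
  apply: max_poly_roots => //.
    by apply/allP => z _; apply/rootP/eqP; have /negP := H z; rewrite negbK.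
  by rewrite map_inj_uniq ?iota_uniq //; apply: mulrIn; rewrite oner_eq0.
by rewrite size_map size_iota ltnn.
Qed.

Lemma size_polyB_le (p q : {poly R}) n :
  (size p <= n)%N -> (size q <= n)%N -> (size (p - q)%R <= n)%N.
Proof.
move=> hp hq; apply: leq_trans (size_polyD _ _) _.
by rewrite size_polyN geq_max hp.
Qed.

Lemma size_polyM_le (p q : {poly R}) m n :
  (size p <= m.+1)%N -> (size q <= n)%N -> (size (p * q)%R <= m + n)%N.
Proof. by move=> hp hq; apply: leq_trans (size_polyMleq _ _) _; lia. Qed.

(** With [k] built from the point [(1, s, s ^+ 2)] of the moment curve, [dot k x] is the value at
    [s] of the polynomial with coefficients [cross u0 x], nonzero off the axis. A common non-root
    works, and [k] gives a chart containing all lines off the axis. *)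
Lemma generic_normal X u0 : exists k, dot k u0 = 0 /\
  forall x, x \in X -> nn x u0 != 0 -> dot k x != 0.
Proof.
pose c x := cross u0 x.
pose p x : {poly R} := Poly [:: (c x).1.1; (c x).1.2; (c x).2].
have [s Hs] : exists s, (\prod_(x <- X | nn x u0 != 0) p x).[s] != 0.
  apply: nonroot; rewrite prodf_seq_neq0; apply/allP => x _; apply/implyP => nx.
  apply: contraNneq nx => p0; rewrite nnC /nn -/(c x).
  have h i : (p x)`_i = 0 by rewrite p0 coef0.
  have := h 0%N; have := h 1%N; have := h 2%N; rewrite !coef_Poly /= => h2 h1 h0.
  by rewrite /dot /c /cross /= h0 h1 h2; apply/eqP; ring.
exists (cross (1, s, s ^+ 2) u0); split.
  by rewrite /dot /cross /=; ring.
move=> x xX nx; move: Hs; rewrite horner_prod prodf_seq_neq0 => /allP/(_ x xX).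
rewrite nx /=; apply: contraNneq => h.
apply/eqP; rewrite -[RHS]h /p horner_Poly /= /c /dot /cross /=; ring.
Qed.

(** Elimination of square roots: only [L], [s ^+ 2] and [t ^+ 2] occur on the right, so if these are
    polynomials the comparison is decided by signs of polynomials. One squaring turns [t <= L + s]
    into [0 <= L + s] and [G <= 2 * L * s]; a second one, split by the sign of [L], removes the
    remaining [s]. *)
Lemma le_add_sqr (s t L : R) : 0 <= s -> 0 <= t ->
  (t <= L + s) =
  ((0 <= L) || (0 <= s ^+ 2 - L ^+ 2)) &&
  (if 0 <= L then (t ^+ 2 - s ^+ 2 - L ^+ 2 <= 0) ||
                  (0 <= 4 * L ^+ 2 * s ^+ 2 - (t ^+ 2 - s ^+ 2 - L ^+ 2) ^+ 2)
   else (t ^+ 2 - s ^+ 2 - L ^+ 2 <= 0) &&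
        (4 * L ^+ 2 * s ^+ 2 - (t ^+ 2 - s ^+ 2 - L ^+ 2) ^+ 2 <= 0)).
Proof.
move=> s0 t0.
set G := t ^+ 2 - s ^+ 2 - L ^+ 2.
have eG : (L + s) ^+ 2 - t ^+ 2 = 2 * L * s - G by rewrite /G; ring.
have eH : 4 * L ^+ 2 * s ^+ 2 - G ^+ 2 = (2 * L * s - G) * (2 * L * s + G) by ring.
have le2 : 0 <= L + s -> (t <= L + s) = (0 <= 2 * L * s - G).
  by move=> Ls; rewrite -eG subr_ge0 ler_sqr ?nnegrE.
rewrite eH; have [L0|L0] := leP 0 L => /=.
  rewrite le2; last by lra.
  have Ls : 0 <= 2 * L * s by rewrite !mulr_ge0.
  have [G0|G0] := leP G 0 => /=; first by apply/idP; lra.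
  by rewrite pmulr_lge0 //; lra.
have Ls : 2 * L * s <= 0 by nra.
have -> : (0 <= s ^+ 2 - L ^+ 2) = (0 <= L + s).
  have -> : s ^+ 2 - L ^+ 2 = (L + s) * (s - L) by ring.
  by rewrite pmulr_lge0 //; lra.
have [sL|sL] := leP 0 (L + s) => /=; last by apply/negbTE; rewrite -ltNge; lra.
rewrite le2 //; have [G0|G0] := leP G 0 => /=; last by apply/negbTE; rewrite -ltNge; lra.
have [h|h] := eqVneq (2 * L * s + G) 0; first by rewrite h mulr0 lexx; apply/idP; lra.
by rewrite nmulr_lle0 // lt_neqAle h; lra.
Qed.

(* Around the axis [u0] each [u] imposes on the position of [x] along its
   generating line a lower bound (side [true]) and an upper bound (side
   [false]). [ins s u x]: [x] satisfies the bound; [on s u x]: it does so with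
   equality; [ge s a b x]: the bound of [a] is at least as strong as that of
   [b] on the line of [x]. *)
Record sweep (X : seq vec) u0 (ys : seq vec) (ge : bool -> vec -> vec -> vec -> bool)
    (ins on : bool -> vec -> vec -> bool) : Prop := Sweep {
  sweep_perm : perm_eq ys [seq x <- X | nn x u0 != 0];
  sweep_ins : forall x u, x \in ys -> nn u u0 != 0 ->
    (nn x u <= nn x u0) = ins true u x && ins false u x;
  sweep_on : forall x u, x \in ys -> nn u u0 != 0 ->
    nn x u = nn x u0 -> on true u x || on false u x;
  sweep_onE : forall s x u, x \in ys -> nn u u0 != 0 -> on s u x -> nn x u = nn x u0;
  sweep_total : forall s a b x, ge s a b x || ge s b a x;
  sweep_trans : forall s a b c x, ge s a b x -> ge s b c x -> ge s a c x;
  sweep_geins : forall s a b x, ge s a b x -> ins s a x -> ins s b x;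
  sweep_onge : forall s a b x, on s a x -> ins s b x -> ge s a b x;
  sweep_geon : forall s a b x, on s a x -> ins s b x -> ge s b a x -> on s b x;
  sweep_chg : forall s a b, nn a u0 != 0 -> nn b u0 != 0 ->
    (chg (map (ge s a b) ys) <= 60)%N }.

Lemma sgr_eq_ge0 (x y : R) : Num.sg x = Num.sg y -> (0 <= x) = (0 <= y).
Proof. by move=> h; rewrite -[LHS]sgr_ge0 h sgr_ge0. Qed.
Lemma sgr_eq_le0 (x y : R) : Num.sg x = Num.sg y -> (x <= 0) = (y <= 0).
Proof. by move=> h; rewrite -[LHS]sgr_le0 h sgr_le0. Qed.

(** Expansion in the orthogonal frame [k], [cross k u0], [u0]. After clearing denominators, both
    sides differ by a multiple of [dot k u0]. *)
Lemma orth_decomp k u0 x : dot k u0 = 0 -> dot k k != 0 -> dot u0 u0 != 0 ->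
  x = lin3 (dot k x / dot k k) (dot (cross k u0) x / (dot k k * dot u0 u0))
        (dot u0 x / dot u0 u0) k (cross k u0) u0.
Proof.
move=> ku0 k0 u00.
have id3 (p : vec -> R) : (p = fun v => v.1.1) \/ (p = fun v => v.1.2) \/
    (p = fun v => v.2) ->
    dot u0 u0 * dot k x * p k + dot (cross k u0) x * p (cross k u0)
    + dot k k * dot u0 x * p u0 = dot k k * dot u0 u0 * p x.
  move=> hp; apply/eqP; rewrite -subr_eq0; apply/eqP.
  transitivity (dot k u0 * (dot u0 x * p k + dot k x * p u0 - dot k u0 * p x)).
    by case: hp => [|[|]] ->; rewrite /dot /cross /=; ring.
  by rewrite ku0 mul0r.
have fin (q1 q2 q3 q4 : R) : dot u0 u0 * dot k x * q1 + dot (cross k u0) x * q2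
    + dot k k * dot u0 x * q3 = dot k k * dot u0 u0 * q4 ->
    q4 = dot k x / dot k k * q1 + dot (cross k u0) x / (dot k k * dot u0 u0) * q2
         + dot u0 x / dot u0 u0 * q3.
  move: (dot k k) (dot u0 u0) (dot k x) (dot _ x) (dot u0 x) k0 u00 => A B D E F A0 B0 h.
  have -> : q4 = (A * B * q4) / (A * B) by field; rewrite A0 B0.
  by rewrite -h; field; rewrite A0 B0.
rewrite /lin3; move: (id3 _ (or_introl erefl)) (id3 _ (or_intror (or_introl erefl)))
  (id3 _ (or_intror (or_intror erefl))).
case: x id3 fin => [[x1 x2] x3] _ fin /fin e1 /fin e2 /fin e3.
by congr (_, _, _).
Qed.

Section Center.
Variables (k u0 : vec).
Let e2 := cross k u0.

(* [x] is a multiple of [k + cw x e2 + crho x u0]: [cw] names the line of [x]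
   and [crho] the position on it. [nn x u <= nn x u0] then says that
   [nn u0 u * crho^2 + 2 * cB u * crho + cC u <= 0], with quarter discriminant
   [cD u]; [clo] is the smaller root, after the reflection of [crho] if the
   side is [false]. *)
Definition cw x := dot e2 x / (dot u0 u0 * dot k x).
Definition crho x := dot k k * dot u0 x / (dot u0 u0 * dot k x).
Definition cB u : {poly R} := Poly [:: bn k u0 u; bn e2 u0 u].
Definition cC u : {poly R} := Poly [:: nn k u - nn k u0;
  2 * (bn k e2 u - bn k e2 u0); nn e2 u - nn e2 u0].
Definition cD u : {poly R} := cB u ^+ 2 - (nn u0 u)%:P * cC u.

Lemma cDE u z : (cD u).[z] = (cB u).[z] ^+ 2 - nn u0 u * (cC u).[z].
Proof. by rewrite /cD !hornerE. Qed.

Lemma size_cB u : (size (cB u) <= 2)%N.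
Proof. exact: size_Poly. Qed.

Lemma size_cD u : (size (cD u) <= 3)%N.
Proof.
apply: size_polyB_le.
  by rewrite expr2 (@size_polyM_le _ _ 1%N 2%N) ?size_cB.
by apply: (@size_polyM_le _ _ 0%N 3%N); [exact: size_polyC_leq1 | exact: size_Poly].
Qed.

(** Completing the square in [crho x]. Since [nn u0 u0 = 0], moving along [u0] does not affect
    [nn _ u0], and the leading coefficient is [nn u0 u]. The factor [c] also undoes the scaling of
    [x] to its representative in the chart. *)
Lemma center_quad x u : dot k u0 = 0 -> dot k x != 0 -> nn x u0 != 0 -> nn u u0 != 0 ->
   exists2 c, 0 < c & c * (nn x u - nn x u0) =
     (nn u0 u * crho x + (cB u).[cw x]) ^+ 2 - (cD u).[cw x].
Proof.
move=> ku0 kx nx nu.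
have al0 : 0 < nn u0 u by rewrite nn_gt0 nnC.
have la0 : dot u0 u0 != 0.
  apply: contraNneq nx => /dot_eq0[h1 h2 h3].
  by rewrite /nn /dot /cross h1 h2 h3 /=; apply/eqP; ring.
have ka0 : dot k k != 0.
  apply: contraNneq kx => /dot_eq0[h1 h2 h3].
  by rewrite /dot h1 h2 h3; apply/eqP; ring.
set d := dot k x / dot k k.
have d0 : d != 0 by rewrite mulf_neq0 // invr_eq0.
have ex v : nn (lin3 1 (cw x) (crho x) k e2 u0) v * d ^+ 2 = nn x v.
  rewrite [in RHS](orth_decomp x ku0 ka0 la0) -/e2 -/d.
  have -> : dot e2 x / (dot k k * dot u0 u0) = d * cw x.
    by rewrite /cw /d; field; rewrite la0 ka0 kx.
  have -> : dot u0 x / dot u0 u0 = d * crho x.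
    by rewrite /crho /d; field; rewrite la0 ka0 kx.
  by rewrite !nn_lin3; ring.
exists (nn u0 u / d ^+ 2).
  by rewrite divr_gt0 // exprn_even_gt0.
rewrite -!ex -mulrBl mulrA mulrAC divfK ?expf_neq0 // cDE !nn_lin3.
have -> : nn u0 u0 = 0 by rewrite /nn /dot /cross /=; ring.
have -> : bn k u0 u0 = 0 by rewrite /bn /dot /cross /=; ring.
have -> : bn e2 u0 u0 = 0 by rewrite /bn /dot /cross /=; ring.
by rewrite /cB /cC !horner_Poly /=; ring.
Qed.

Definition sgb (s : bool) : R := if s then 1 else -1.
Definition clo s u (z : R) :=
  (- (sgb s * (cB u).[z]) - Num.sqrt (cD u).[z]) / nn u0 u.
Definition cins s u x := (0 <= (cD u).[cw x]) && (clo s u (cw x) <= sgb s * crho x).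
Definition con s u x := (0 <= (cD u).[cw x]) && (clo s u (cw x) == sgb s * crho x).
(** A negative discriminant means an empty interval, which counts as the strongest bound; this keeps
    the comparison total and transitive. *)
Definition cge s a b x := ((cD a).[cw x] < 0) ||
  ((0 <= (cD b).[cw x]) && (clo s b (cw x) <= clo s a (cw x))).

(** Cleared of denominators, the comparison of roots says that [nn u0 b] times the root of [cD a] is
    at most [Lp] plus [nn u0 a] times the root of [cD b], which [le_add_sqr] decides by signs. The
    six polynomials have total size at most 19, hence at most 38 changes; 60 leaves room. *)
Lemma chg_cge s a b (ys : seq vec) : nn a u0 != 0 -> nn b u0 != 0 ->
  sorted <=%R (map cw ys) -> (chg (map (cge s a b) ys) <= 60)%N.
Proof.
rewrite ![nn _ u0]nnC -!nn_gt0 => al0a al0b sys.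
pose Lp : {poly R} := (sgb s * nn u0 a)%:P * cB b - (sgb s * nn u0 b)%:P * cB a.
pose E1 : {poly R} := (nn u0 a ^+ 2)%:P * cD b.
pose E2 : {poly R} := (nn u0 b ^+ 2)%:P * cD a.
pose G : {poly R} := E2 - E1 - Lp ^+ 2.
pose H : {poly R} := 4%:P * Lp ^+ 2 * E1 - G ^+ 2.
pose ps := [:: cD a; cD b; Lp; E1 - Lp ^+ 2; G; H].
apply: leq_trans (@chg_signs _ _ _ cw _ ps _ sys _) _.
  move=> x y /= [hDa hDb hL hEL hG hH].
  rewrite /cge !(ltNge _ 0) (sgr_eq_ge0 hDa) (sgr_eq_ge0 hDb).
  have [Da|//] := leP 0 (cD a).[cw y]; have [Db|//] := leP 0 (cD b).[cw y] => /=.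
  have Da' : 0 <= (cD a).[cw x] by rewrite (sgr_eq_ge0 hDa).
  have Db' : 0 <= (cD b).[cw x] by rewrite (sgr_eq_ge0 hDb).
  have cmp z : 0 <= (cD a).[z] -> 0 <= (cD b).[z] -> (clo s b z <= clo s a z) =
      ((0 <= Lp.[z]) || (0 <= (E1 - Lp ^+ 2).[z])) &&
      (if 0 <= Lp.[z] then (G.[z] <= 0) || (0 <= H.[z])
       else (G.[z] <= 0) && (H.[z] <= 0)).
    move=> Daz Dbz; rewrite /clo ler_pdivrMr // mulrAC ler_pdivlMr //.
    have e1 : E1.[z] = (nn u0 a * Num.sqrt (cD b).[z]) ^+ 2.
      by rewrite exprMn sqr_sqrtr // /E1 !hornerE.
    have e2' : E2.[z] = (nn u0 b * Num.sqrt (cD a).[z]) ^+ 2.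
      by rewrite exprMn sqr_sqrtr // /E2 !hornerE.
    have -> : H.[z] = 4 * Lp.[z] ^+ 2 * E1.[z] - (E2.[z] - E1.[z] - Lp.[z] ^+ 2) ^+ 2.
      by rewrite /H /G !hornerE.
    have -> : G.[z] = E2.[z] - E1.[z] - Lp.[z] ^+ 2 by rewrite /G !hornerE.
    have -> : (E1 - Lp ^+ 2).[z] = E1.[z] - Lp.[z] ^+ 2 by rewrite !hornerE.
    rewrite e1 e2' -le_add_sqr ?mulr_ge0 ?sqrtr_ge0 ?(ltW al0a) ?(ltW al0b) //.
    rewrite /Lp !hornerE; apply/idP/idP; lra.
  by rewrite !cmp // (sgr_eq_ge0 hL) (sgr_eq_ge0 hEL) (sgr_eq_le0 hG) (sgr_eq_ge0 hH)
     (sgr_eq_le0 hH).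
have sC (c : R) : (size c%:P <= 1)%N by exact: size_polyC_leq1.
have sL : (size Lp <= 2)%N.
  by apply: size_polyB_le; apply: (@size_polyM_le _ _ 0%N 2%N); rewrite ?sC ?size_cB.
have sL2 : (size (Lp ^+ 2) <= 3)%N by rewrite expr2 (@size_polyM_le _ _ 1%N 2%N).
have sE1 : (size E1 <= 3)%N by apply: (@size_polyM_le _ _ 0%N 3%N); rewrite ?sC ?size_cD.
have sE2 : (size E2 <= 3)%N by apply: (@size_polyM_le _ _ 0%N 3%N); rewrite ?sC ?size_cD.
have sG : (size G <= 3)%N by rewrite !size_polyB_le.
have sH : (size H <= 5)%N.
  apply: size_polyB_le; last by rewrite expr2 (@size_polyM_le _ _ 2%N 3%N).
  by apply: (@size_polyM_le _ _ 2%N 3%N) => //; apply: (@size_polyM_le _ _ 0%N 3%N).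
have sEL : (size (E1 - Lp ^+ 2)%R <= 3)%N by rewrite size_polyB_le.
rewrite /ps !big_cons big_nil; have := size_cD a; have := size_cD b.
move: sL sEL sG sH; lia.
Qed.

End Center.

(** Sorting by [cw] lists the points in the order in which a half-turn about the axis meets their
    lines. *)
Lemma sweepP X u0 : exists ys ge ins on, sweep X u0 ys ge ins on.
Proof.
have [k [ku0 kX]] := generic_normal X u0.
exists (sort (relpre (cw k u0) <=%R) [seq x <- X | nn x u0 != 0]),
  (cge k u0), (cins k u0), (con k u0).
set ys := sort _ _.
have ysE x : x \in ys -> nn x u0 != 0 /\ dot k x != 0.
  by rewrite mem_sort mem_filter => /andP[nx xX]; split=> //; apply: kX.
split.
- by rewrite perm_sort.
- move=> x u /ysE[nx kx] nu; have [c c0 ec] := center_quad ku0 kx nx nu.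
  have al0 : 0 < nn u0 u by rewrite nn_gt0 nnC.
  rewrite -subr_le0 -(pmulr_rle0 _ c0) ec subr_le0 /cins.
  have [D0|D0] := leP 0 (cD k u0 u).[cw k u0 x] => /=; last first.
    by apply/negbTE; rewrite -ltNge (lt_le_trans D0) // sqr_ge0.
  rewrite -{1}(sqr_sqrtr D0) -[_ ^+ 2]real_normK ?num_real //.
  rewrite ler_sqr ?nnegrE ?sqrtr_ge0 // ler_norml /clo /sgb !ler_pdivrMr //.
  by congr (_ && _); apply/idP/idP; lra.
- move=> x u /ysE[nx kx] nu e; have [c c0] := center_quad ku0 kx nx nu.
  have al0 : nn u0 u != 0 by rewrite nnC.
  rewrite e subrr mulr0 => /esym/eqP; rewrite subr_eq0 => /eqP eq.
  have D0 : 0 <= (cD k u0 u).[cw k u0 x] by rewrite -eq sqr_ge0.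
  rewrite /con D0 /= /clo; move: eq; rewrite -{1}(sqr_sqrtr D0) => /eqP.
  rewrite eqf_sqr => /orP[]/eqP eq; apply/orP.
    by right; rewrite -eq /sgb; apply/eqP; field.
  by left; rewrite /sgb -[Num.sqrt _]opprK -eq; apply/eqP; field.
- move=> s x u /ysE[nx kx] nu /andP[D0 /eqP e].
  have [c c0 ec] := center_quad ku0 kx nx nu.
  have al0 : nn u0 u != 0 by rewrite nnC.
  apply/eqP; rewrite -subr_eq0 -(mulrI_eq0 _ (mulfI (lt0r_neq0 c0))) ec subr_eq0; apply/eqP.
  rewrite -[RHS](sqr_sqrtr D0); move: e; rewrite /clo => e.
  have -> : Num.sqrt (cD k u0 u).[cw k u0 x] =
      - (sgb s * (nn u0 u * crho k u0 x + (cB k u0 u).[cw k u0 x])).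
    by rewrite mulrDr (mulrCA (sgb s)) -e; field.
  by rewrite sqrrN exprMn (_ : sgb s ^+ 2 = 1) ?mul1r // /sgb; case: s {e}; ring.
- move=> s a b x; rewrite /cge; case: ltP => //= Da; case: ltP => //= Db.
  exact: le_total.
- move=> s a b c x; rewrite /cge; case: ltP => //= Da /andP[Db ab].
  by rewrite ltNge Db /= => /andP[-> /le_trans]; apply.
- move=> s a b x; rewrite /cge /cins; case: ltP => //= Da /andP[-> ab] /=.
  exact: le_trans.
- by move=> s a b x; rewrite /con /cins /cge => /andP[Da /eqP ->] /andP[-> ->]; rewrite orbT.
- move=> s a b x; rewrite /con /cins /cge => /andP[Da /eqP ea] /andP[Db lb].
  by rewrite ltNge Db Da /= ea => ge; rewrite eq_le lb.
move=> s a b na nb; apply: chg_cge => //.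
by rewrite sorted_map; apply: sort_sorted => x y; apply: le_total.
Qed.

End Vectors.

(** * Five tied points *)

Section FivePoints.
Variable R : rcfType.
Local Notation vec := (vec R).
Implicit Types (x y z u v a b : vec).

Definition det x y z : R := dot x (cross y z).

Lemma coords_parallel x y u v (e : R) : nn x y != 0 ->
  dot x u = e * dot x v -> dot y u = e * dot y v ->
  dot (cross x y) u = e * dot (cross x y) v -> nn u v = 0.
Proof.
move=> n0 hx hy hn.
pose z : vec := (u.1.1 - e * v.1.1, u.1.2 - e * v.1.2, u.2 - e * v.2).
have zx : dot x z = 0 by move: hx; rewrite /dot /z /= => /eqP; rewrite -subr_eq0 => /eqP <-; ring.
have zy : dot y z = 0 by move: hy; rewrite /dot /z /= => /eqP; rewrite -subr_eq0 => /eqP <-; ring.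
have zn : dot (cross x y) z = 0.
  by move: hn; rewrite /dot /z /= => /eqP; rewrite -subr_eq0 => /eqP <-; ring.
have z0 (p : vec -> R) : (p = fun v => v.1.1) \/ (p = fun v => v.1.2) \/
    (p = fun v => v.2) -> p z = 0.
  move=> hp; suff: nn x y * p z = 0.
    by move/eqP; rewrite mulf_eq0 (negbTE n0) => /eqP.
  transitivity (dot x z * p (cross y (cross x y)) + dot y z * p (cross (cross x y) x)
    + dot (cross x y) z * p (cross x y)).
    by case: hp => [|[|]] ->; rewrite /nn /dot /cross /=; ring.
  by rewrite zx zy zn; ring.
have := z0 _ (or_introl erefl); have := z0 _ (or_intror (or_introl erefl)).
have := z0 _ (or_intror (or_intror erefl)).
rewrite /z /= => /eqP; rewrite subr_eq0 => /eqP h3 /eqP; rewrite subr_eq0 => /eqP h2 /eqP.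
by rewrite subr_eq0 => /eqP h1; rewrite /nn /dot /cross /= h1 h2 h3; ring.
Qed.

(** As [nn x u] is [dot x x * dot u u - dot x u ^+ 2], once [u] and [v] are known to have equal
    length their projections to the plane of [x] and [y] agree up to sign. So [u] is, up to sign,
    [v] or its mirror image in that plane. *)
Lemma equal_on_plane x y u v : nn x y != 0 -> nn x u = nn x v -> nn y u = nn y v ->
  bn x y u = bn x y v -> exists e : R, [/\ e ^+ 2 = 1, dot x u = e * dot x v,
    dot y u = e * dot y v & (dot (cross x y) u = e * dot (cross x y) v \/
     dot (cross x y) u = - (e * dot (cross x y) v))].
Proof.
move=> n0 h1 h2 h3.
have eh w : dot (cross x y) w ^+ 2 = nn x y * dot w w -
   (dot y w ^+ 2 * dot x x - 2 * dot x w * dot y w * dot x y + dot x w ^+ 2 * dot y y).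
  by rewrite /nn /dot /cross /=; ring.
have en w w' : nn w w' = dot w w * dot w' w' - dot w w' ^+ 2.
  by rewrite /nn /dot /cross /=; ring.
have eb w : bn x y w = dot x y * dot w w - dot x w * dot y w.
  by rewrite /bn /dot /cross /=; ring.
have eu := eh u; have ev := eh v; clear eh; move: eu ev; move: h1 h2 h3; rewrite !en !eb.
move: n0; rewrite -nn_gt0 en.
move: (dot (cross x y) u) (dot (cross x y) v) => hu hv.
have := dot_ge0 x; have := dot_ge0 y.
move: (dot x x) (dot y y) (dot x y) (dot u u) (dot v v) => A B d L L'.
move: (dot x u) (dot x v) (dot y u) (dot y v) => p p' q q' B0 A0 D0 h1 h2 h3 h4 h5.
have A1 : 0 < A by nra.
have eL : L = L'.
  apply/eqP; rewrite -subr_eq0; apply/eqP.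
  (* The Gram form of [x], [y] at [(q - q', p' - p)], a vector on which the squares of the
     functionals [(p, q)] and [(p', q')] agree. Hence [f * (L - L') = 0], and definiteness settles
     the case [f = 0]. *)
  pose f := A * (q - q') ^+ 2 - 2 * d * (p - p') * (q - q') + B * (p - p') ^+ 2.
  have fL : f * (L - L') = 0.
    have -> : f * (L - L') = (A * (L - L')) * (q - q') ^+ 2
      - 2 * (d * (L - L')) * (p - p') * (q - q') + B * (L - L') * (p - p') ^+ 2.
      by rewrite /f; ring.
    have -> : A * (L - L') = p ^+ 2 - p' ^+ 2 by lra.
    have -> : B * (L - L') = q ^+ 2 - q' ^+ 2 by lra.
    have -> : d * (L - L') = p * q - p' * q' by lra.
    by ring.
  move/eqP: fL; rewrite mulf_eq0 => /orP[/eqP f0|/eqP //].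
  have Af : (A * (q - q') - d * (p - p')) ^+ 2 + (A * B - d ^+ 2) * (p - p') ^+ 2 = 0.
    by rewrite -(mulr0 A) -f0 /f; ring.
  have s1 := sqr_ge0 (A * (q - q') - d * (p - p')).
  have s2 := sqr_ge0 (p - p').
  have : (p - p') ^+ 2 = 0 by nra.
  move/eqP; rewrite sqrf_eq0 subr_eq0 => /eqP pp.
  have /eqP : A * (L - L') = 0 by rewrite pp in h1; lra.
  by rewrite mulf_eq0 gt_eqF //= => /eqP.
rewrite {}eL {L} in h1 h2 h3 h4.
have pp : p ^+ 2 = p' ^+ 2 by lra.
have qq : q ^+ 2 = q' ^+ 2 by lra.
have pq : p * q = p' * q' by lra.
have [e [e1 ep eq']] : exists e : R, [/\ e ^+ 2 = 1, p = e * p' & q = e * q'].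
  have [p0|p0] := eqVneq p' 0.
    have {}p0' : p = 0 by apply/eqP; rewrite -sqrf_eq0 pp p0 expr0n.
    move/eqP: qq; rewrite eqf_sqr => /orP[]/eqP ->.
      by exists 1; rewrite expr1n p0 p0' !mul1r.
    by exists (-1); rewrite sqrrN expr1n p0 p0' mulr0 mulN1r.
  move/eqP: pp; rewrite eqf_sqr => /orP[]/eqP ep; rewrite ep in pq.
    exists 1; rewrite expr1n !mul1r; split=> //; exact: (mulfI p0).
  exists (-1); rewrite sqrrN expr1n !mulN1r; split=> //.
  by apply: (mulfI p0); rewrite mulrN -pq mulNr opprK.
exists e; split=> //.
have hh : hu ^+ 2 = (e * hv) ^+ 2.
  rewrite exprMn e1 mul1r h4 h5 ep eq'.
  transitivity ((A * B - d ^+ 2) * L' - e ^+ 2 *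
    (q' ^+ 2 * A - 2 * p' * q' * d + p' ^+ 2 * B)); first by ring.
  by rewrite e1; ring.
by move/eqP: hh; rewrite eqf_sqr => /orP[]/eqP; [left|right].
Qed.

Lemma pencil_trivial (mu nu P Q S : R) : 0 < P -> 0 < Q -> 0 < S ->
  mu * (S - Q) - nu * Q = 0 -> - (mu * P) + nu * (S - P) = 0 -> mu * P + nu * Q = 0 ->
  mu = 0 /\ nu = 0.
Proof.
move=> P0 Q0 S0 h1 h2 h3.
have nuE : nu * (S + Q - P) = 0 by lra.
have muE : mu * (S + P - Q) = 0 by lra.
move/eqP: nuE; rewrite mulf_eq0 => /orP[]/eqP e1; move/eqP: muE;
  rewrite mulf_eq0 => /orP[]/eqP e2; try by split.
- split=> //; move/eqP: h3; rewrite e1 mul0r addr0 mulf_eq0 (gt_eqF P0) orbF.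
  by move/eqP.
- split=> //; move/eqP: h3; rewrite e2 mul0r add0r mulf_eq0 (gt_eqF Q0) orbF.
  by move/eqP.
- by exfalso; lra.
Qed.

Section Fixed.
Variables (u0 a b : vec).
Hypotheses (na : nn u0 a != 0) (nb : nn u0 b != 0) (nab : nn a b != 0).

(** If the three forms agreed on a plane, [a] and [b], not being parallel to [u0], would both be
    parallel to the mirror image of [u0], hence to each other. *)
Lemma no_common_plane x y : nn x y != 0 ->
  nn x a = nn x u0 -> nn x b = nn x u0 -> nn y a = nn y u0 -> nn y b = nn y u0 ->
  bn x y a = bn x y u0 -> bn x y b = bn x y u0 -> False.
Proof.
move=> nxy xa xb ya yb xya xyb.
have [e [e1 ex ey eh]] := equal_on_plane nxy xa ya xya.
have [f [f1 fx fy fh]] := equal_on_plane nxy xb yb xyb.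
case: eh => eh.
  by move: na; rewrite nnC (coords_parallel nxy ex ey eh) eqxx.
case: fh => fh.
  by move: nb; rewrite nnC (coords_parallel nxy fx fy fh) eqxx.
have ff t : e * f * (f * t) = e * t by rewrite mulrA -(mulrA e f f) -expr2 f1 mulr1.
move: nab; rewrite (@coords_parallel x y a b (e * f)) ?eqxx //.
- by rewrite ex fx ff.
- by rewrite ey fy ff.
- by rewrite eh fh mulrN ff.
Qed.

Definition tied x := (nn x a == nn x u0) && (nn x b == nn x u0).

(** A quadratic form on a plane is determined by its values at three pairwise independent vectors,
    so coplanar tied points would make the three forms agree on that plane. *)
Lemma tied_det x y z : nn x y != 0 -> nn y z != 0 -> nn x z != 0 ->
  tied x -> tied y -> tied z -> det x y z != 0.
Proof.
move=> nxy nyz nxz /andP[/eqP xa /eqP xb] /andP[/eqP ya /eqP yb] /andP[/eqP za /eqP zb].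
apply/negP => /eqP d0.
pose al := dot z (cross y (cross x y)); pose be := dot z (cross (cross x y) x).
have ez u : nn x y ^+ 2 * nn z u =
    al ^+ 2 * nn x u + be ^+ 2 * nn y u + 2 * (al * be) * bn x y u.
  have -> : nn x y ^+ 2 * nn z u =
    nn (lin3 al be (det x y z) x y (cross x y)) u.
    by rewrite /nn /det /al /be /lin3 /dot /cross /=; ring.
  by rewrite d0 nn_lin3; ring.
have al0 : al != 0.
  apply: contraNneq nyz => al0.
  have := ez y; rewrite al0 expr0n /= !mul0r mulr0 add0r mul0r addr0.
  have -> : nn y y = 0 by rewrite /nn /dot /cross /=; ring.
  by rewrite mulr0 => /eqP; rewrite mulf_eq0 sqrf_eq0 (negbTE nxy) nnC.
have be0 : be != 0.
  apply: contraNneq nxz => be0.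
  have := ez x; rewrite be0 expr0n /= mulr0 !mulr0 !mul0r !addr0.
  have -> : nn x x = 0 by rewrite /nn /dot /cross /=; ring.
  by rewrite mulr0 => /eqP; rewrite mulf_eq0 sqrf_eq0 (negbTE nxy) nnC.
have c0 : 2 * (al * be) != 0 by rewrite !mulf_neq0 // pnatr_eq0.
have eqb u : nn x u = nn x u0 -> nn y u = nn y u0 -> nn z u = nn z u0 ->
    bn x y u = bn x y u0.
  move=> h1 h2 h3; apply: (mulfI c0); have := ez u; have := ez u0.
  rewrite h1 h2 h3; lra.
by apply: (no_common_plane nxy xa xb ya yb); apply: eqb.
Qed.

(** Tied points are common zeros of two conics. A member [g] of their pencil is made to contain the
    line through [x1] and [x2]; the other three points lie off it, hence on the second line of [g],
    although they are not collinear. So [g] vanishes identically, which its values at [u0], [a], [b]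
    forbid. *)
Lemma no_five_tied x1 x2 x3 x4 x5 :
  pairwise (fun x y => nn x y != 0) [:: x1; x2; x3; x4; x5] ->
  all tied [:: x1; x2; x3; x4; x5] -> False.
Proof.
rewrite /= !andbT => /and4P[/and4P[n12 n13 n14 n15] /and3P[n23 n24 n25] /andP[n34 n35] n45].
case/and5P=> t1 t2 t3 t4 t5.
have tE x : tied x -> nn x a = nn x u0 /\ nn x b = nn x u0 by case/andP=> /eqP ? /eqP.
(* Chosen so that the polar form satisfies [p x1 x2 = 0]: with the zeros [x1], [x2], this makes [g]
   vanish on their whole plane. *)
pose mu := bn x1 x2 b - bn x1 x2 u0; pose nu := - (bn x1 x2 a - bn x1 x2 u0).
pose g y := mu * (nn y a - nn y u0) + nu * (nn y b - nn y u0).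
pose p y z := mu * (bn y z a - bn y z u0) + nu * (bn y z b - bn y z u0).
have gt x : tied x -> g x = 0 by case/tE=> ea eb; rewrite /g ea eb !subrr !mulr0 addr0.
pose D := det x1 x2 x3.
have D0 : D != 0 by apply: tied_det.
have gE z : D ^+ 2 * g z = 2 * det x1 x2 z *
    (det z x2 x3 * p x1 x3 + det x1 z x3 * p x2 x3).
  have ez u : D ^+ 2 * nn z u =
      nn (lin3 (det z x2 x3) (det x1 z x3) (det x1 x2 z) x1 x2 x3) u.
    have eD (q : vec -> R) : (q = fun v => v.1.1) \/ (q = fun v => v.1.2) \/
      (q = fun v => v.2) -> det z x2 x3 * q x1 + det x1 z x3 * q x2 + det x1 x2 z * q x3
      = D * q z.
      by case=> [|[|]] ->; rewrite /D /det /dot /cross /=; ring.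
    rewrite /lin3 (eD _ (or_introl erefl)) (eD _ (or_intror (or_introl erefl))).
    rewrite (eD _ (or_intror (or_intror erefl))) /nn /dot /cross /=; ring.
  rewrite /g (_ : D ^+ 2 * _ = mu * (D ^+ 2 * nn z a - D ^+ 2 * nn z u0)
    + nu * (D ^+ 2 * nn z b - D ^+ 2 * nn z u0)); last by ring.
  have [e1a e1b] := tE _ t1; have [e2a e2b] := tE _ t2; have [e3a e3b] := tE _ t3.
  rewrite !ez !nn_lin3 e1a e1b e2a e2b e3a e3b /p /mu /nu; ring.
have red z : tied z -> det x1 x2 z != 0 ->
    det z x2 x3 * p x1 x3 + det x1 z x3 * p x2 x3 = 0.
  move=> tz dz; have := gE z; rewrite gt // mulr0 => /esym/eqP.
  by rewrite mulf_eq0 mulf_eq0 pnatr_eq0 /= (negbTE dz) => /eqP.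
have r4 := red x4 t4 (tied_det n12 n24 n14 t1 t2 t4).
have r5 := red x5 t5 (tied_det n12 n25 n15 t1 t2 t5).
have d345 : det x3 x4 x5 != 0 by apply: tied_det.
(* A Plücker relation: the determinant of the linear system that [x4] and [x5] impose on [p x1 x3]
   and [p x2 x3]. *)
have plu : det x4 x2 x3 * det x1 x5 x3 - det x5 x2 x3 * det x1 x4 x3 = D * det x3 x4 x5.
  by rewrite /D /det /dot /cross /=; ring.
have p13 : p x1 x3 = 0.
  have : D * det x3 x4 x5 * p x1 x3 = 0.
    rewrite -plu.
    transitivity (det x1 x5 x3 * (det x4 x2 x3 * p x1 x3 + det x1 x4 x3 * p x2 x3)
      - det x1 x4 x3 * (det x5 x2 x3 * p x1 x3 + det x1 x5 x3 * p x2 x3)); first by ring.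
    by rewrite r4 r5; ring.
  by move/eqP; rewrite mulf_eq0 (negbTE (mulf_neq0 D0 d345)) => /eqP.
have p23 : p x2 x3 = 0.
  have : D * det x3 x4 x5 * p x2 x3 = 0.
    rewrite -plu.
    transitivity (det x4 x2 x3 * (det x5 x2 x3 * p x1 x3 + det x1 x5 x3 * p x2 x3)
      - det x5 x2 x3 * (det x4 x2 x3 * p x1 x3 + det x1 x4 x3 * p x2 x3)); first by ring.
    by rewrite r4 r5; ring.
  by move/eqP; rewrite mulf_eq0 (negbTE (mulf_neq0 D0 d345)) => /eqP.
have g0 z : g z = 0.
  have /eqP := gE z; rewrite p13 p23 !mulr0 addr0 mulr0 mulf_eq0 sqrf_eq0 (negbTE D0).
  by move=> /eqP.
have nz u : nn u u = 0 by rewrite /nn /dot /cross /=; ring.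
have := g0 u0; have := g0 a; have := g0 b; rewrite /g !nz ![nn _ u0]nnC (nnC b a).
move: na nb nab; rewrite -!nn_gt0.
have mn : ~ (mu = 0 /\ nu = 0).
  case=> m0 n0; have [e1a e1b] := tE _ t1; have [e2a e2b] := tE _ t2.
  apply: (no_common_plane n12 e1a e1b e2a e2b); apply/eqP; rewrite -subr_eq0.
    by rewrite -oppr_eq0 -/nu n0.
  by rewrite -/mu m0.
move=> P0 Q0 S0 h1 h2 h3; apply: mn.
rewrite ?subr0 ?sub0r ?mulrN in h1 h2 h3; exact: pencil_trivial P0 Q0 S0 h1 h2 h3.
Qed.

Lemma tied_le4 (xs : seq vec) : uniq xs ->
  {in xs &, forall x y, x != y -> nn x y != 0} -> all tied xs -> (size xs <= 4)%N.
Proof.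
move=> uxs pxs txs; rewrite leqNgt; apply/negP => sz.
have : pairwise (fun x y => nn x y != 0) xs.
  by apply/(pairwiseP (0,0,0)) => i j ij;
  rewrite ?inE => hi hj; apply: pxs; rewrite ?mem_nth //;
  rewrite nth_uniq // ltn_eqF.
case: xs txs sz {uxs pxs} => [|x1 [|x2 [|x3 [|x4 [|x5 xs]]]]] // txs _ pw.
apply: (@no_five_tied x1 x2 x3 x4 x5).
  by move: pw; rewrite -[[:: x1, x2, x3, x4, x5 & xs]]/([:: x1; x2; x3; x4; x5] ++ xs)
    pairwise_cat => /and3P[].
by move: txs; rewrite -[[:: x1, x2, x3, x4, x5 & xs]]/([:: x1; x2; x3; x4; x5] ++ xs)
  all_cat => /andP[].
Qed.

End Fixed.
End FivePoints.

(** * Incidences *)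

Section Blocks.
Local Open Scope nat_scope.
Variable T : eqType.
Implicit Types (s : seq T) (c d : T).

Lemma chg_del c d s : chg (c :: s) <= chg [:: c, d & s].
Proof.
case: s => [|e s] //; rewrite !chg_cons2.
have [->|_] := eqVneq c d; first by rewrite add0n.
by rewrite addnA leq_add2r; case: (_ != _); case: (_ != _).
Qed.

Lemma chg_behead c s : chg s <= chg (c :: s).
Proof. by rewrite /= leq_addl. Qed.

Lemma chg_cons_le c s : chg (c :: s) <= (chg s).+1.
Proof. by case: s => [|d s] //; rewrite chg_cons2; case: (_ != _); lia. Qed.

Lemma chg_subseq s1 s2 : subseq s1 s2 -> chg s1 <= chg s2.
Proof.
have key c t1 t2 : subseq t1 t2 -> chg (c :: t1) <= chg (c :: t2).
  elim: t2 t1 c => [|d t2 IH] [|e t1] c //.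
  rewrite [subseq _ _]/=; case: eqP => [->|_] h.
    by rewrite !chg_cons2 leq_add2l IH.
  exact: leq_trans (IH _ c h) (chg_del _ _ _).
elim: s2 s1 => [|d s2 IH] [|e s1] //; rewrite [subseq _ _]/=.
case: eqP => [->|_] h; first exact: key.
by apply: leq_trans (IH _ h) _; exact: chg_behead.
Qed.

Local Arguments chg : simpl never.

(** Away from ties the word is the word of codes with omissions, which create no change; a tie
    replaces one code by at most two letters and costs at most four changes. *)
Lemma chg_blocks (X : eqType) (B : X -> seq T) (code : X -> T) (tie : pred X)
    (F : seq X) c :
  {in F, forall x, if tie x then size (B x) <= 2
                   else (B x == [::]) || (B x == [:: code x])} ->
  chg (c :: flatten (map B F)) <= chg (c :: map code F) + 4 * count tie F.
Proof.
elim: F c => [|x F IH] c HB //.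
have {}IH d := IH d (fun y yF => HB y (mem_behead (s := x :: F) yF)).
have := HB x (mem_head _ _); rewrite /= => HBx.
have h0 := chg_del c (code x) (map code F).
have h1 : chg (map code F) <= chg (c :: map code F) by exact: chg_behead.
move: HBx; case: ifP => _ => [|/orP[]/eqP->]; last first.
- rewrite cat1s !chg_cons2 add0n; have := IH (code x); lia.
- by rewrite cat0s add0n; have := IH c; lia.
case: (B x) => [|d [|e []]] // _; rewrite ?cat0s ?cat_cons ?cat0s.
- by have := IH c; lia.
- have := IH d; have := chg_cons_le d (map code F).
  by rewrite (chg_cons2 c d); case: (_ != _); lia.
- have := IH e; have := chg_cons_le e (map code F).
  by rewrite (chg_cons2 c d) (chg_cons2 d e); case: (_ != _); case: (_ != _); lia.
Qed.

Lemma uniq_size_chg s : uniq s -> size s <= (chg s).+1.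
Proof.
elim: s => [|x [|y s] IH] // /andP[xs us]; rewrite chg_cons2.
have -> : x != y by apply: contraNneq xs => ->; rewrite mem_head.
by have := IH us; rewrite /=; lia.
Qed.

(** Inside a block of distinct letters all positions but one are changes. This converts bounds on
    changes into counts of incidences. *)
Lemma size_flatten_chg (bs : seq (seq T)) : all uniq bs ->
  size (flatten bs) <= size bs + chg (flatten bs).
Proof.
elim: bs => //= b bs IH /andP[ub ubs]; rewrite size_cat.
by have := chg_cat_ge b (flatten bs); have := uniq_size_chg ub; have := IH ubs; lia.
Qed.

End Blocks.

Local Arguments chg : simpl never.

Section Incidences.
Variable R : realType.
Local Notation vec := (vec R).
Implicit Types (x y u v a b : vec) (X U S : seq vec).

(** [m] stands for the square of twice the maximum area. Excluding parallel vectors makes the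
    cylinders distinct and puts the points on distinct lines through the origin; both roles are
    symmetric because [nn] is. *)
Record config (m : R) X U : Prop := Config {
  conf_gt0 : 0 < m;
  conf_uX : uniq X;
  conf_uU : uniq U;
  conf_nX : {in X, forall x, dot x x != 0};
  conf_nU : {in U, forall x, dot x x != 0};
  conf_X : {in X &, forall x y, x != y -> nn x y != 0};
  conf_U : {in U &, forall x y, x != y -> nn x y != 0};
  conf_le : {in X & U, forall x u, nn x u <= m} }.

Definition deg (m : R) x U := count (fun u => nn x u == m) U.

Definition incidences (m : R) X U : nat := (\sum_(x <- X) deg m x U)%N.

Lemma config_sub m X U X' U' : config m X U -> uniq X' -> uniq U' ->
  {subset X' <= X} -> {subset U' <= U} -> config m X' U'.
Proof.
case=> m0 uX uU nX nU pX pU le uX' uU' sX sU; split=> //.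
- by move=> x /sX; apply: nX.
- by move=> x /sU; apply: nU.
- by move=> x y /sX xX /sX yX; apply: pX.
- by move=> x y /sU xX /sU yX; apply: pU.
- by move=> x u /sX xX /sU uU''; apply: le.
Qed.

Lemma config_sym m X U : config m X U -> config m U X.
Proof.
by case=> m0 uX uU nX nU pX pU le; split=> // u x uU' xX; rewrite nnC; apply: le.
Qed.

Lemma incidencesC m X U : incidences m X U = incidences m U X.
Proof.
rewrite /incidences /deg.
under eq_bigr do rewrite -sum1_count big_mkcond /=.
rewrite exchange_big /=; apply: eq_bigr => u _; rewrite -sum1_count [RHS]big_mkcond /=.
by apply: eq_bigr => x _; rewrite nnC.
Qed.

(** Every point is inside every cylinder, so at a point of the cylinder of [u0] a bound met with
    equality is a strongest one. Unless both [a] and [b] tie there, the only letter possible is the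
    stronger of the two, [code x]. The codes change at most 60 times; the prepended letter adds 1
    and the at most four ties add 4 each. *)
Lemma pairchg_ties m X U u0 ys ge ins on s : config m X U -> u0 \in U ->
  sweep X u0 ys ge ins on ->
  pairchg 77 (flatten [seq [seq a <- U | (a != u0) && on s a x]
                      | x <- ys & nn x u0 == m]).
Proof.
move=> cf u0U sw a b; set B := fun x => [seq a <- U | _]; set F := [seq x <- ys | _].
have flat : [seq z <- flatten (map B F) | pred2 a b z] =
    flatten [seq [seq z <- B x | pred2 a b z] | x <- F].
  by elim: (F) => //= x G IH; rewrite filter_cat IH.
rewrite {}flat.
have cst d : (forall x, {in [seq z <- B x | pred2 a b z], forall z, z = d}) ->
    (chg (flatten [seq [seq z <- B x | pred2 a b z] | x <- F]) <= 77)%N.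
  move=> H; rewrite (@chg_const _ d) //; apply/allP => z /flatten_mapP[x _ /H ->].
  exact: eqxx.
have [ab|nab] := eqVneq a b.
  by apply: (cst a) => x z; rewrite mem_filter /= ab => /andP[/orP[]/eqP].
pose ok z := (z \in U) && (z != u0).
have okB x z : z \in B x -> ok z by rewrite mem_filter /ok => /andP[/andP[-> _] ->].
have [oka|oka] := boolP (ok a); last first.
  apply: (cst b) => x z; rewrite mem_filter /= => /andP[/orP[]/eqP -> //].
  by move=> /okB; rewrite (negbTE oka).
have [okb|okb] := boolP (ok b); last first.
  apply: (cst a) => x z; rewrite mem_filter /= => /andP[/orP[]/eqP -> //].
  by move=> /okB; rewrite (negbTE okb).
have [aU a0] := andP oka; have [bU b0] := andP okb.
have na : nn a u0 != 0 by apply: (conf_U cf).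
have nb : nn b u0 != 0 by apply: (conf_U cf).
have FE x : x \in F -> [/\ x \in ys, x \in X & nn x u0 = m].
  rewrite mem_filter => /andP[/eqP e xys]; split=> //.
  by move: xys; rewrite (perm_mem (sweep_perm sw)) mem_filter => /andP[].
have insF x u : x \in F -> u \in U -> u != u0 -> ins s u x.
  move=> /FE[xys xX e] uU uu0.
  have nu : nn u u0 != 0 by apply: (conf_U cf).
  have := sweep_ins sw xys nu; rewrite e (conf_le cf xX uU) => /esym/andP[].
  by case: (s).
pose tie := tied u0 a b.
pose code x := if ge s a b x then a else b.
have tie4 : (count tie F <= 4)%N.
  rewrite -size_filter; apply: (@tied_le4 _ u0 a b).
  - by rewrite nnC.
  - by rewrite nnC.
  - exact: (conf_U cf).
  - rewrite !filter_uniq // (perm_uniq (sweep_perm sw)) filter_uniq //.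
    exact: (conf_uX cf).
  - move=> x y; rewrite !mem_filter => /andP[_ xF] /andP[_ yF].
    by apply: (conf_X cf); [case: (FE x); rewrite ?mem_filter|case: (FE y); rewrite ?mem_filter].
  - exact: filter_all.
have key := @chg_blocks _ _ (fun x => [seq z <- B x | pred2 a b z]) code tie F a.
apply: (@leq_trans (chg (a :: flatten [seq [seq z <- B x | pred2 a b z] | x <- F]))).
  by exact: chg_behead.
apply: leq_trans (key _) _ => {key}.
  move=> x xF; have [xys xX e] := FE _ xF; rewrite -filter_predI.
  have uB : uniq [seq z <- U | predI (pred2 a b) (fun z => (z != u0) && on s z x) z].
    by rewrite filter_uniq // (conf_uU cf).
  case: ifP => tx.
    apply: (@leq_trans (size [:: a; b])) => //; apply: uniq_leq_size => // z.
    by rewrite mem_filter !inE => /andP[/andP[]].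
  have oncode z : z \in [seq z <- U | predI (pred2 a b) (fun z => (z != u0) && on s z x) z]
      -> z = code x.
    rewrite mem_filter /= => /andP[/andP[/orP[]/eqP-> /andP[_ onx]] _]; rewrite /code.
      by rewrite (sweep_onge sw onx) // insF.
    case: ifP => // gab; exfalso.
    have ona := sweep_geon sw onx (insF _ _ xF aU a0) gab.
    move: tx; rewrite /tie /tied (sweep_onE sw xys na ona) (sweep_onE sw xys nb onx).
    by rewrite eqxx.
  move: uB oncode; case: (seq.filter _ _) => [|z [|z' t]] //= uB oncode.
    by rewrite (oncode z) ?mem_head // eqxx orbT.
  move: uB; rewrite (oncode z) ?inE ?eqxx // (oncode z') ?inE ?eqxx ?orbT //.
have : (chg (map code F) <= 60)%N.
  apply: (@leq_trans (chg (map (ge s a b) F))).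
    by apply: chg_map_factor => x y e; rewrite /code e.
  apply: leq_trans (sweep_chg sw s na nb).
  by apply/chg_subseq/map_subseq/filter_subseq.
move=> h; apply: (@leq_trans (61 + 4 * 4)) => //; apply: leq_add.
  by apply: leq_trans (chg_cons_le _ _) _; rewrite ltnS.
by rewrite leq_mul2l.
Qed.

(** A cylinder through a point of the cylinder of [u0] is [u0] itself or meets its lower or upper
    bound with equality there, so it is listed in one of two words. The blocks of each word are the
    [deg m u0 X] points on the cylinder. *)
Lemma tie_bound (eps : R) : 0 < eps -> exists2 C : R, 1 <= C &
  forall m X U u0, config m X U -> u0 \in U ->
   (\sum_(x <- X | nn x u0 == m) deg m x U)%:R <=
   C * ((deg m u0 X)%:R + (size U)%:R `^ (1 + eps)).
Proof.
move=> e0; have [C0 C00 HC] := davenport_schinzel 77 e0.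
exists (3 + 2 * C0) => [|m X U u0 cf u0U]; first by lra.
have [ys [ge [ins [on sw]]]] := sweepP X u0.
pose B s x := [seq a <- U | (a != u0) && on s a x].
pose F := [seq x <- ys | nn x u0 == m].
have pF : perm_eq F [seq x <- X | nn x u0 == m].
  have := perm_filter (fun x => nn x u0 == m) (sweep_perm sw).
  rewrite -filter_predI.
  rewrite (_ : [seq x <- X | predI _ _ x] = [seq x <- X | nn x u0 == m]) //.
  apply: eq_filter => x /=; case: (nn x u0 =P m) => //= ->.
  by rewrite gt_eqF ?(conf_gt0 cf).
have sF : size F = deg m u0 X.
  by rewrite (perm_size pF) size_filter; apply: eq_count => x; rewrite nnC.
rewrite -big_filter -(perm_big _ pF) /=.
have HW s : ((\sum_(x <- F) size (B s x))%N)%:R <=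
    (size F)%:R + C0 * (size U)%:R `^ (1 + eps).
  have -> : (\sum_(x <- F) size (B s x))%N = size (flatten (map (B s) F)).
    by elim: (F) => [|x G IH]; rewrite ?big_nil // big_cons /= size_cat IH.
  have ub : all uniq (map (B s) F).
    by apply/allP => t /mapP[x _ ->]; rewrite filter_uniq // (conf_uU cf).
  have := size_flatten_chg ub; rewrite size_map -(ler_nat R) natrD => /le_trans; apply.
  rewrite lerD2l; apply: le_trans (HC _ _ (pairchg_ties s cf u0U sw)) _.
  rewrite ler_wpM2l // ler_natpow //; first by lra.
  apply: uniq_leq_size (undup_uniq _) _ => z; rewrite mem_undup => /flatten_mapP[x _].
  by rewrite mem_filter => /andP[].
have : (\sum_(x <- F) deg m x U <=
    size F + (\sum_(x <- F) size (B true x) + \sum_(x <- F) size (B false x)))%N.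
  rewrite -big_split -sum1_size -big_split /=.
  rewrite big_seq [leqRHS]big_seq; apply: leq_sum => x.
  rewrite mem_filter => /andP[/eqP xu0 xys].
  rewrite /deg /B !size_filter.
  have <- : count_mem u0 U = 1%N by rewrite (count_uniq_mem _ (conf_uU cf)) u0U.
  have cU (P Q : pred vec) : (count (predU P Q) U <= count P U + count Q U)%N.
    by rewrite -count_predUI leq_addr.
  apply: leq_trans (leq_add (leqnn _) (cU _ _)); apply: leq_trans (cU _ _).
  rewrite -!size_filter; apply: uniq_leq_size; first by rewrite filter_uniq // (conf_uU cf).
  move=> a; rewrite !mem_filter => /andP[/eqP xa aU]; rewrite aU andbT /=.
  have [//|au] := eqVneq a u0.
  by apply: (sweep_on sw) => //; [apply: (conf_U cf) | rewrite xa].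
rewrite -(ler_nat R) => /le_trans; apply; rewrite !natrD -sF.
have := HW true; have := HW false.
have := powR_ge0 (size U)%:R (1 + eps); have : 0 <= (size F)%:R :> R by [].
move: (_ `^ _) => p; move: (size F)%:R => f; move: (_%:R) => w1; move: (_%:R) => w2.
nra.
Qed.

End Incidences.

(** * Labels and hitting sets *)

Section Labels.
Local Open Scope nat_scope.
Variables (T : eqType) (X : eqType) (ge : T -> T -> X -> bool).
Hypothesis ge_total : forall a b x, ge a b x || ge b a x.
Hypothesis ge_trans : forall a b c x, ge a b x -> ge b c x -> ge a c x.
Implicit Types (S : seq T) (d : T).

(** Ties go to the earliest element of [S], so that for [a] before [b] the choice between the two is
    read off from [ge a b] alone; [d] is returned only for empty [S]. *)
Definition best S d x := nth d S (find (fun a => all (fun b => ge a b x) S) S).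

Lemma has_max S x : S != [::] -> has (fun a => all (fun b => ge a b x) S) S.
Proof.
have refl a : ge a a x by have := ge_total a a x; rewrite orbb.
elim: S => // c [|d S] IH _; first by rewrite /= refl.
have /hasP[a aS /allP amax] := IH isT; apply/hasP.
have [ca|] := boolP (ge c a x).
  exists c; rewrite ?mem_head //; apply/allP => b; rewrite inE => /predU1P[->//|bS].
  exact: ge_trans ca (amax b bS).
have := ge_total c a x; case: (ge c a x) => //= ac _.
have amax' : all (fun b => ge a b x) [:: c, d & S].
  by apply/allP => b; rewrite inE => /predU1P[->//|/amax].
by exists a => //; rewrite inE aS orbT.
Qed.

Lemma best_mem S d x : S != [::] -> best S d x \in S.
Proof. by move=> /(has_max x); rewrite has_find => ?; rewrite mem_nth. Qed.

Lemma best_max S d x b : b \in S -> ge (best S d x) b x.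
Proof.
move=> bS; have Sn : S != [::] by case: (S) bS.
by have /(nth_find d)/allP/(_ b bS) := has_max x Sn.
Qed.

Lemma best_first S d x a : uniq S -> a \in S -> index a S < index (best S d x) S ->
  ~~ ge a (best S d x) x.
Proof.
move=> uS aS lt; apply/negP => gab.
have Sn : S != [::] by case: (S) aS.
move: lt; rewrite index_uniq // -?has_find ?has_max //.
move/(before_find d)/negbT; rewrite nth_index // => /negP; apply.
by apply/allP => b bS; apply: ge_trans gab (best_max _ _ bS).
Qed.

Lemma best_pairchg K S d (ys : seq X) : uniq S ->
  {in S &, forall a b, chg (map (ge a b) ys) <= K} ->
  pairchg K (map (best S d) ys).
Proof.
move=> uS HK a b.
have cst c : (forall z, z \in [seq z <- map (best S d) ys | pred2 a b z] -> z = c) ->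
    chg [seq z <- map (best S d) ys | pred2 a b z] <= K.
  by move=> H; rewrite (@chg_const _ c) //; apply/allP => z /H ->; exact: eqxx.
have [S0|Sn] := eqVneq S [::].
  by apply: (cst d) => z; rewrite mem_filter => /andP[_ /mapP[x _ ->]]; rewrite S0.
have [aS|aS] := boolP (a \in S); last first.
  apply: (cst b) => z; rewrite mem_filter => /andP[/orP[]/eqP -> // /mapP[x _ ea]].
  by rewrite ea best_mem in aS.
have [bS|bS] := boolP (b \in S); last first.
  apply: (cst a) => z; rewrite mem_filter => /andP[/orP[]/eqP -> // /mapP[x _ ea]].
  by rewrite ea best_mem in bS.
wlog lt : a b aS bS {cst} / index a S < index b S.
  move=> W; case: (ltngtP (index a S) (index b S)) => [|lt|e]; first exact: W.
    rewrite (eq_filter (a2 := pred2 b a)); first exact: W.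
    by move=> z /=; rewrite orbC.
  apply: (cst a) => z; rewrite mem_filter.
  have -> : b = a by rewrite -(nth_index d aS) e nth_index.
  by rewrite /= orbb => /andP[/eqP].
rewrite filter_map; set zs := seq.filter _ _.
have -> : map (best S d) zs = [seq if ge a b x then a else b | x <- zs].
  apply/eq_in_map => x; rewrite mem_filter /= => /andP[/orP[]/eqP e _].
    by rewrite -e best_max.
  have := @best_first S d x a uS aS; rewrite e => /(_ lt) h.
  by rewrite (negbTE h).
apply: (@leq_trans (chg (map (ge a b) zs))).
  by apply: chg_map_factor => x y ->.
apply: leq_trans (HK a b aS bS).
by apply/chg_subseq/map_subseq/filter_subseq.
Qed.

End Labels.

Lemma label_blocks (X T : eqType) (lab : X -> T) (ys : seq X) :
  exists bs : seq (seq X), [/\ flatten bs = ys,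
    (size bs <= (chg (map lab ys)).+1)%N &
    {in bs, forall b, exists c, {in b, forall x, lab x = c}}].
Proof.
suff [bs [e1 e2 e3 e4]] : exists bs : seq (seq X), [/\ flatten bs = ys,
    (size bs <= (chg (map lab ys)).+1)%N,
    {in bs, forall b, exists c, {in b, forall x, lab x = c}} & [::] \notin bs].
  by exists bs.
elim: ys => [|x ys [bs [e1 e2 e3 e4]]]; first by exists [::].
case: ys e1 e2 => [|y ys] e1 e2.
  exists [:: [:: x]]; split=> // b; rewrite inE => /eqP ->.
  by exists (lab x) => z; rewrite inE => /eqP ->.
case: bs e1 e2 e3 e4 => [|[|y' b] bs] //= [] -> e1 e2 e3 e4.
rewrite chg_cons2; have [exy|nxy] := eqVneq (lab x) (lab y).
  exists ([:: x, y & b] :: bs); split=> //=; first by rewrite e1.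
    move=> c; rewrite inE => /predU1P[->|cbs]; last by apply: e3; rewrite inE cbs orbT.
    have [|l Hl] := e3 (y :: b); first by rewrite mem_head.
    exists l => z; rewrite inE => /predU1P[->|]; last exact: Hl.
    by rewrite exy Hl // mem_head.
exists ([:: x] :: (y :: b) :: bs); split=> //=; first by rewrite e1.
by move=> c; rewrite inE => /predU1P[->|/e3 //]; exists (lab x) => z; rewrite inE => /eqP ->.
Qed.

Section Hitting.
Variable R : realType.

Lemma sum_lt_const (T : eqType) (U : seq T) (f : T -> R) (c : R) :
  U != [::] -> {in U, forall u, f u < c} -> \sum_(u <- U) f u < (size U)%:R * c.
Proof.
elim: U => // u [|v U] IH _ H; first by rewrite big_seq1 mul1r H // mem_head.
rewrite big_cons [size _]/= -natr1 mulrDl mul1r addrC ltrD //; last by rewrite H // mem_head.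
by apply: IH => // w wU; apply: H; rewrite inE wU orbT.
Qed.

(** Greedy choice: by averaging, some element of [U] hits at least the fraction [t / n] of the
    ranges still missed. *)
Lemma hitting_set (T J : eqType) (U : seq T) (Js : seq J) (rng : J -> pred T) (t n : R)
    (q : nat) : 0 < t -> (size U)%:R <= n -> t <= n ->
  {in Js, forall j, t <= (count (rng j) U)%:R} ->
  exists S : seq T, [/\ {subset S <= U}, (size S <= q)%N &
   (count (fun j => ~~ has (rng j) S) Js)%:R <= (size Js)%:R * (1 - t / n) ^+ q].
Proof.
move=> t0 sU tn Ht; have n0 : 0 < n by apply: lt_le_trans tn.
elim: q => [|q [S [SU sS cS]]].
  exists [::]; split=> //; rewrite expr0 mulr1 ler_nat.
  exact: count_size.
set Js' := [seq j <- Js | ~~ has (rng j) S].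
pose hit u := count (rng ^~ u) Js'.
have tot : (size Js')%:R * t <= \sum_(u <- U) (hit u)%:R.
  have -> : \sum_(u <- U) (hit u)%:R = \sum_(j <- Js') (count (rng j) U)%:R :> R.
    rewrite -!natr_sum; congr (_%:R); rewrite /hit.
    under eq_bigr do rewrite -sum1_count big_mkcond /=.
    rewrite exchange_big /=; apply: eq_bigr => j _.
    by rewrite -sum1_count [RHS]big_mkcond.
  have -> : (size Js')%:R * t = \sum_(j <- Js') t.
    by rewrite big_const_seq count_predT iter_addr_0 mulr_natl.
  rewrite big_seq [leRHS]big_seq; apply: ler_sum => j; rewrite mem_filter => /andP[_].
  exact: Ht.
have sJ : (size Js')%:R <= (size Js)%:R * (1 - t / n) ^+ q by rewrite size_filter.
have [J0|Jn] := eqVneq Js' [::].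
  exists S; split=> //; first exact: leqW.
  rewrite -size_filter -/Js' J0 /= mulr_ge0 // exprn_ge0 // subr_ge0.
  by rewrite ler_pdivrMr // mul1r.
have sJ0 : 0 < (size Js')%:R :> R by rewrite ltr0n lt0n size_eq0.
have [u uU hu] : exists2 u, u \in U & (size Js')%:R * t / n <= (hit u)%:R.
  apply: contrapT => H.
  have lt : {in U, forall u, (hit u)%:R < (size Js')%:R * t / n}.
    by move=> u uU; rewrite ltNge; apply/negP => h; apply: H; exists u.
  have Un : U != [::].
    apply/eqP => U0; move: tot; rewrite U0 big_nil leNgt => /negP; apply.
    exact: mulr_gt0.
  have := sum_lt_const Un lt; rewrite ltNge => /negP; apply; apply: le_trans tot.
  apply: (@le_trans _ _ (n * ((size Js')%:R * t / n))).
    by rewrite ler_wpM2r // divr_ge0 ?mulr_ge0 // ltW.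
  by rewrite mulrC divfK ?gt_eqF.
exists (u :: S); split=> //.
  by move=> v; rewrite inE => /predU1P[->|/SU].
rewrite [in X in X%:R](eq_count (a2 := predI (fun j => ~~ rng j u) (fun j => ~~ has (rng j) S)));
  last by move=> j /=; rewrite negb_or.
rewrite -count_filter -/Js'.
have -> : (count (fun j => ~~ rng j u) Js')%:R = (size Js')%:R - (hit u)%:R :> R.
  rewrite -(count_predC (rng ^~ u) Js') natrD addrAC subrr add0r.
  by [].
rewrite exprSr mulrA; apply: (@le_trans _ _ ((size Js')%:R * (1 - t / n))).
  by rewrite mulrBr mulr1 mulrA lerB.
rewrite ler_wpM2r // subr_ge0.
by rewrite ler_pdivrMr // mul1r.
Qed.

End Hitting.

(** * The incidence bound *)

Section Bounds.
Variable R : realType.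
Local Notation vec := (vec R).
Implicit Types (x y u v a b : vec) (X U S : seq vec).

Lemma sum_deg_sqr m X U : (\sum_(u <- U) deg m u X * deg m u X =
  \sum_(x <- X) \sum_(u <- U | nn u x == m) deg m u X)%N.
Proof.
under [RHS]eq_bigr do rewrite big_mkcond /=.
rewrite exchange_big /=; apply: eq_bigr => u _.
rewrite -big_mkcond /= big_const_seq iter_addn_0; congr (_ * _)%N.
Qed.

(* Take [t = C + p / q]. *)
Lemma quad_opt (C p q : R) (I : R) : 1 <= C -> 0 <= p -> 0 < q -> 0 <= I ->
  (forall t, 2 * t * I <= C * (I + p ^+ 2) + t ^+ 2 * q ^+ 2) ->
  I <= 2 * C * (q ^+ 2 + q * p).
Proof.
move=> C1 p0 q0 I0 H; pose r := p / q.
have r0 : 0 <= r by rewrite divr_ge0 // ltW.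
have pE : p = r * q by rewrite /r divfK // gt_eqF.
have := H (C + r); rewrite pE => {}H.
have t0 : 0 < C + r by lra.
have : (C + r) * I <= (C + r) * (q ^+ 2 * (C * r + C + r)).
  have : C * (r * q) ^+ 2 <= (C + r) * (C * r) * q ^+ 2.
    have -> : C * (r * q) ^+ 2 = C * r ^+ 2 * q ^+ 2 by ring.
    by apply: ler_wpM2r; [exact: sqr_ge0 | nra].
  have : 0 <= r * I by rewrite mulr_ge0.
  move: H; set Q := q ^+ 2; nra.
rewrite ler_pM2l // => /le_trans; apply.
have : 0 <= q ^+ 2 by rewrite sqr_ge0.
rewrite (_ : q * (r * q) = r * q ^+ 2); last by ring.
move: (q ^+ 2) => Q Q0.
rewrite (_ : 2 * C * (Q + r * Q) = Q * (2 * C + 2 * C * r)); last by ring.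
rewrite ler_wpM2l //; nra.
Qed.

(** Second moment method: regrouped by points, the sum of the squared degrees is bounded by
    [tie_bound] with both roles exchanged; the squared deviations from a free value [t] then have a
    nonnegative sum. *)
Lemma pair_bound (eps : R) : 0 < eps -> exists2 C : R, 1 <= C &
  forall m X U, config m X U -> (incidences m X U)%:R <=
    C * ((size U)%:R + Num.sqrt (size U)%:R * (size X)%:R `^ (1 + eps)).
Proof.
(* The loss is halved by the square root: [p ^+ 2] is [|X| * |X|^(1 + 2 eps)]. *)
move=> e0; have [|C C1 HC] := @tie_bound R (2 * eps); first by lra.
exists (2 * C) => [|m X U cf]; first by lra.
have [U0|Un] := eqVneq U [::].
  rewrite incidencesC U0 /incidences big_nil mulr_ge0 //; first by lra.
set q := Num.sqrt _; have q0 : 0 < q by rewrite sqrtr_gt0 ltr0n lt0n size_eq0.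
have qE : (size U)%:R = q ^+ 2 by rewrite sqr_sqrtr.
rewrite qE; set p := _ `^ _; set I := incidences m X U.
apply: quad_opt => //; first exact: powR_ge0.
move=> t.
have sq : \sum_(u <- U) (deg m u X)%:R ^+ 2 <= C * (I%:R + p ^+ 2).
  have -> : \sum_(u <- U) (deg m u X)%:R ^+ 2 =
      \sum_(x <- X) (\sum_(u <- U | nn u x == m) deg m u X)%:R :> R.
    rewrite -natr_sum -sum_deg_sqr natr_sum; apply: eq_bigr => u _.
    by rewrite natrM expr2.
  have -> : C * (I%:R + p ^+ 2) =
     \sum_(x <- X) C * ((deg m x U)%:R + (size X)%:R `^ (1 + 2 * eps)).
    rewrite -big_distrr /= big_split /= -natr_sum; congr (_ * (_ + _)).
    rewrite big_const_seq count_predT iter_addr_0 -[RHS]mulr_natl /p.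
    rewrite -powR_mulrn ?powR_ge0 // -powRrM.
    rewrite -[X in _ = X * _]powRr1 // -powRD; last first.
      by apply/implyP => /eqP h; exfalso; lra.
    by congr (_ `^ _); ring.
  rewrite big_seq [leRHS]big_seq; apply: ler_sum => x xX.
  exact: HC (config_sym cf) xX.
have : 0 <= \sum_(u <- U) ((deg m u X)%:R - t) ^+ 2.
  by apply: sumr_ge0 => u _; exact: sqr_ge0.
have -> : \sum_(u <- U) ((deg m u X)%:R - t) ^+ 2 =
    \sum_(u <- U) (deg m u X)%:R ^+ 2 - 2 * t * I%:R + t ^+ 2 * q ^+ 2.
  rewrite /I incidencesC /incidences natr_sum big_distrr /= -sumrB -qE.
  have -> : t ^+ 2 * (size U)%:R = \sum_(u <- U) t ^+ 2.
    by rewrite big_const_seq count_predT iter_addr_0 mulr_natr.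
  by rewrite -big_split; apply: eq_bigr => u _ /=; ring.
by move: sq; lra.
Qed.

Lemma parallel_trans x y u : dot u u != 0 -> nn x u = 0 -> nn y u = 0 -> nn x y = 0.
Proof.
move=> u0 /dot_eq0[x1 x2 x3] /dot_eq0[y1 y2 y3].
suff: dot u u ^+ 4 * nn x y = 0.
  by move/eqP; rewrite mulf_eq0 expf_eq0 /= (negbTE u0) => /eqP.
have ex z : (cross z u).1.1 = 0 -> (cross z u).1.2 = 0 -> (cross z u).2 = 0 ->
    [/\ dot u u * z.1.1 = dot z u * u.1.1, dot u u * z.1.2 = dot z u * u.1.2
      & dot u u * z.2 = dot z u * u.2].
  rewrite /cross /dot /= => h1 h2 h3; split; apply/eqP; rewrite -subr_eq0; apply/eqP.
  - transitivity (u.1.2 * (z.1.1 * u.1.2 - z.1.2 * u.1.1) - u.2 * (z.2 * u.1.1 - z.1.1 * u.2)).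
      by ring.
    by rewrite h2 h3; ring.
  - transitivity (u.1.1 * - (z.1.1 * u.1.2 - z.1.2 * u.1.1) + u.2 * (z.1.2 * u.2 - z.2 * u.1.2)).
      by ring.
    by rewrite h1 h3; ring.
  - transitivity (u.1.1 * (z.2 * u.1.1 - z.1.1 * u.2) + u.1.2 * - (z.1.2 * u.2 - z.2 * u.1.2)).
      by ring.
    by rewrite h1 h2; ring.
have [a1 a2 a3] := ex _ x1 x2 x3; have [b1 b2 b3] := ex _ y1 y2 y3.
transitivity (nn (dot u u * x.1.1, dot u u * x.1.2, dot u u * x.2)
  (dot u u * y.1.1, dot u u * y.1.2, dot u u * y.2)).
  by rewrite /nn /dot /cross /=; ring.
by rewrite a1 a2 a3 b1 b2 b3 /nn /dot /cross /=; ring.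
Qed.

(* The [u] that strictly beat [u0] at some point of a slice of [ys] lying
   between the bounds of [u1] and [u2]; [u1 = u0] or [u2 = u0] stands for no
   bound. *)
Definition conflict (ys : seq vec) (ins : bool -> vec -> vec -> bool) u0 u1 u2 i l u :=
  has (fun x => [&& (u1 == u0) || ins true u1 x, (u2 == u0) || ins false u2 x
                  & nn x u0 < nn x u]) (take l (drop i ys)).

(** Points on the cylinder of [u0] are covered by [tie_bound], and at most one point is on its axis.
    The others are cut, in sweep order, into blocks on which both envelope labels of the sample are
    constant; [pair_bound] is applied to each block and its conflict list. *)
Lemma center_bound (eps C0 C1 C2 : R) m X U S n t u0 ys ge ins on (P : pred vec) :
  0 < eps -> 1 <= C0 -> 1 <= C1 -> 0 <= C2 ->
  (forall m X U u0, config m X U -> u0 \in U ->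
   (\sum_(x <- X | nn x u0 == m) deg m x U)%:R <=
   C0 * ((deg m u0 X)%:R + (size U)%:R `^ (1 + eps))) ->
  (forall m X U, config m X U -> (incidences m X U)%:R <=
    C1 * ((size U)%:R + Num.sqrt (size U)%:R * (size X)%:R `^ (1 + eps))) ->
  (forall (T : eqType) (W : seq T), pairchg 60 W ->
    (chg W)%:R <= C2 * (size (undup W))%:R `^ (1 + eps)) ->
  config m X U -> (size X <= n)%N -> (size U <= n)%N -> 0 <= t ->
  uniq S -> {subset S <= U} -> u0 \in S ->
  sweep X u0 ys ge ins on ->
  {in X, forall x, P x -> {in S, forall u, nn x u <= nn x u0}} ->
  (forall u1 u2 i l, u1 \in U -> u2 \in U -> (i <= size X)%N -> (l <= size X)%N ->
    ~~ has (conflict ys ins u0 u1 u2 i l) S ->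
    (count (conflict ys ins u0 u1 u2 i l) U)%:R <= t) ->
  (\sum_(x <- X | P x) deg m x U)%:R <=
   C0 * (n%:R + n%:R `^ (1 + eps)) + n%:R
   + C1 * t * (2 * (C2 * (size S)%:R `^ (1 + eps)) + 1)
   + C1 * Num.sqrt t * n%:R `^ eps * (count P X)%:R.
Proof.
move=> e0 C01 C11 C20 tieB pairB dsB cf sX sU t0 uS SU u0S sw Pmax small.
have u0U := SU _ u0S.
have degU x : (deg m x U <= n)%N by apply: leq_trans (count_size _ _) sU.
rewrite (bigID (fun x => nn x u0 == m)) /= natrD.
rewrite [X in _ + X%:R](bigID (fun x => nn x u0 == 0)) /= natrD addrA.
rewrite -[leRHS]addrA; apply: lerD; first apply: lerD.
- apply: (@le_trans _ _ (\sum_(x <- X | nn x u0 == m) deg m x U)%:R).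
    by rewrite ler_nat [leqRHS](bigID P) /= (eq_bigl _ _ (fun x => andbC (P x) _)) leq_addr.
  apply: le_trans (tieB _ _ _ _ cf u0U) _; rewrite ler_wpM2l //; first by lra.
  apply: lerD; last by rewrite ler_natpow //; lra.
  by rewrite ler_nat (leq_trans _ sX) // count_size.
- rewrite ler_nat -big_filter; set Z := seq.filter _ _.
  have : (size Z <= 1)%N.
    have Zp x : x \in Z -> x \in X /\ nn x u0 = 0.
      by rewrite mem_filter => /andP[/andP[_ /eqP ->] ->].
    have uZ : uniq Z by rewrite filter_uniq // (conf_uX cf).
    case: Z Zp uZ => [|x [|y Z]] //= Zp /andP[xy _].
    have [xX x0] := Zp x (mem_head _ _).
    have [yX y0] : y \in X /\ nn y u0 = 0 by apply: Zp; rewrite !inE eqxx orbT.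
    have : nn x y != 0.
      by apply: (conf_X cf) => //; apply: contraNneq xy => ->; rewrite mem_head.
    by rewrite (parallel_trans (conf_nU cf u0U) x0 y0) eqxx.
  case: Z => [|x [|]] // _; first by rewrite big_nil.
  by rewrite big_seq1.
pose Q x := P x && (nn x u0 != m).
have -> : (\sum_(x <- X | (P x && (nn x u0 != m)) && (nn x u0 != 0%R)) deg m x U =
    \sum_(x <- ys | Q x) deg m x U)%N.
  rewrite (perm_big _ (sweep_perm sw)) /= big_filter_cond.
  by apply: eq_bigl => x; rewrite andbC.
have uys : uniq ys by rewrite (perm_uniq (sweep_perm sw)) filter_uniq // (conf_uX cf).
have ysX : {subset ys <= X}.
  by move=> x; rewrite (perm_mem (sweep_perm sw)) mem_filter => /andP[].
have sys : (size ys <= size X)%N by apply: uniq_leq_size.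
have nS u : u \in S -> u != u0 -> nn u u0 != 0.
  by move=> uS' uu0; apply: (conf_U cf) => //; exact: SU.
pose S0 := [seq u <- S | u != u0].
have S0E u : u \in S0 -> u \in S /\ u != u0 by rewrite mem_filter => /andP[].
(* The default [u0] appears only if the sample has no other element, in agreement with the
   convention of [conflict]. *)
pose lab s := best (ge s) S0 u0.
have labP s : pairchg 60 (map (lab s) ys).
  apply: best_pairchg; rewrite ?filter_uniq //; first exact: sweep_total sw s.
    exact: sweep_trans sw s.
  by move=> a b /S0E[aS a0] /S0E[bS b0]; apply: (sweep_chg sw); apply: nS.
have labU s x : lab s x \in S.
  have [S0n|S0n] := eqVneq S0 [::]; first by rewrite /lab /best S0n.
  by have /S0E[] := best_mem (sweep_total sw s) (@sweep_trans _ _ _ _ _ _ _ sw s) u0 x S0n.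
have chglab s : (chg (map (lab s) ys))%:R <= C2 * (size S)%:R `^ (1 + eps).
  apply: le_trans (dsB _ _ (labP s)) _; rewrite ler_wpM2l // ler_natpow //; first by lra.
  by apply: uniq_leq_size (undup_uniq _) _ => z; rewrite mem_undup => /mapP[x _ ->].
have [bs [fbs sbs cbs]] := label_blocks (fun x => (lab true x, lab false x)) ys.
have {}sbs : (size bs)%:R <= 2 * (C2 * (size S)%:R `^ (1 + eps)) + 1.
  have := chg_map_le (f := fun x => (lab true x, lab false x)) (g1 := lab true)
    (g2 := lab false) ys.
  move=> /(_ (fun x y e1 e2 => congr2 pair e1 e2)).
  rewrite -(ler_nat R) natrD => h.
  move: sbs; rewrite -(ler_nat R) -natr1 => h'.
  by have := chglab true; have := chglab false; lra.
have block (b : seq vec) : b \in bs -> (\sum_(x <- b | Q x) deg m x U)%:R <=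
    C1 * t + C1 * Num.sqrt t * n%:R `^ eps * (count Q b)%:R.
  move=> bbs; have [[u1 u2] lb] := cbs b bbs.
  have [bs1 [bs2 ebs]] : exists bs1 bs2, bs = bs1 ++ b :: bs2.
    by case/splitPr: bbs => bs1 bs2; exists bs1, bs2.
  pose i := size (flatten bs1); pose l := size b.
  have eys : ys = flatten bs1 ++ b ++ flatten bs2 by rewrite -fbs ebs flatten_cat.
  have eb : take l (drop i ys) = b.
    by rewrite eys drop_size_cat // take_size_cat.
  have ub : uniq b by move: uys; rewrite eys !cat_uniq => /and3P[_ _ /and3P[]].
  have bys : {subset b <= ys} by move=> x xb; rewrite eys !mem_cat xb orbT.
  have [b0|bn] := eqVneq b [::].
    rewrite b0 big_nil /= mulr0 addr0 mulr_ge0 //; lra.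
  have il : (i <= size X)%N && (l <= size X)%N.
    have sz : (i + (l + size (flatten bs2)) <= size X)%N.
      by rewrite -!size_cat -eys.
    rewrite (leq_trans _ sz) ?leq_addr //= (leq_trans _ sz) //.
    by apply: leq_trans (leq_addl _ _); exact: leq_addr.
  have [x0 x0b] : exists x0, x0 \in b by case: (b) bn => // x0 b' _; exists x0; rewrite mem_head.
  have u1S : u1 \in S by have := labU true x0; have [-> _] := lb x0 x0b.
  have u2S : u2 \in S by have := labU false x0; have [_ ->] := lb x0 x0b.
  pose cfl := conflict ys ins u0 u1 u2 i l.
  (* No sampled [u] is in conflict with the block: the labels are at least as strong as its bounds,
     so a point satisfying the labels is inside [u]. *)
  have cfl_le : (count cfl U)%:R <= t.
    case/andP: il => ii ll; apply: small => //; try exact: SU.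
    apply/hasPn => u uS'; apply/negP => /hasP[x]; rewrite eb => xb /and3P[i1 i2 lt].
    have uu0 : u != u0 by apply: contraTneq lt => ->; rewrite ltxx.
    have uS0 : u \in S0 by rewrite mem_filter uu0.
    have S0n : S0 != [::] by case: (S0) uS0.
    have [e1 e2] := lb x xb.
    have mx s := best_max (sweep_total sw s) (@sweep_trans _ _ _ _ _ _ _ sw s) u0 x uS0.
    have mm s := best_mem (sweep_total sw s) (@sweep_trans _ _ _ _ _ _ _ sw s) u0 x S0n.
    have /S0E[_ n1] := mm true; have /S0E[_ n2] := mm false.
    rewrite -/(lab true x) e1 in n1; rewrite -/(lab false x) e2 in n2.
    rewrite (negbTE n1) /= in i1; rewrite (negbTE n2) /= in i2.
    have g1 := mx true; rewrite -/(lab true x) e1 in g1.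
    have g2 := mx false; rewrite -/(lab false x) e2 in g2.
    have := sweep_ins sw (bys _ xb) (nS _ uS' uu0).
    by rewrite (sweep_geins sw g1 i1) (sweep_geins sw g2 i2) leNgt lt.
  pose Xt := [seq x <- b | Q x]; pose Rt := [seq u <- U | cfl u].
  (* An incident [u] has [nn x u = m > nn x u0], while [Pmax] places [x] within the bounds of both
     labels; so [u] is on the conflict list. *)
  have degE x : x \in Xt -> deg m x U = deg m x Rt.
    rewrite mem_filter => /andP[/andP[Px xm] xb].
    rewrite /deg /Rt count_filter; apply: eq_in_count => u uU /=.
    case: (nn x u =P m) => //= xu; apply/esym/hasP; exists x; first by rewrite eb.
    have xX := ysX _ (bys _ xb).
    have lem := conf_le cf xX u0U.
    have insx s v : v \in S -> v != u0 -> ins s v x.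
      move=> vS v0; have := sweep_ins sw (bys _ xb) (nS _ vS v0).
      by rewrite (Pmax _ xX Px) // => /esym/andP[]; case: s.
    rewrite xu lt_neqAle xm lem /= andbT; apply/andP; split.
      by have [//|h] := eqVneq u1 u0; rewrite insx.
    by have [//|h] := eqVneq u2 u0; rewrite insx.
  have -> : (\sum_(x <- b | Q x) deg m x U = incidences m Xt Rt)%N.
    by rewrite -big_filter big_seq /incidences [RHS]big_seq; apply: eq_bigr.
  have cft : config m Xt Rt.
    apply: (config_sub cf); rewrite ?filter_uniq ?(conf_uU cf) //.
      by move=> x; rewrite mem_filter => /andP[_ /bys/ysX].
    by move=> u; rewrite mem_filter => /andP[].
  apply: le_trans (pairB _ _ _ cft) _; rewrite size_filter -/cfl -!mulrA -mulrDr.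
  rewrite ler_wpM2l //; first by lra.
  apply: lerD => //; apply: ler_pM; rewrite ?sqrtr_ge0 ?powR_ge0 ?ler_wsqrtr //.
  (* Replacing only the factor [|Xt|^eps] by [n^eps] keeps the term linear in the block, so that it
     sums to [count P X]. *)
  rewrite -(size_filter Q b) -/Xt powRD; last by rewrite gt_eqF ?implybT //; lra.
  rewrite powRr1 // mulrC ler_wpM2r // ler_natpow // (leq_trans _ sX) //.
  by apply: uniq_leq_size; [exact: (conf_uX cft) | move=> x; rewrite mem_filter => /andP[_ /bys/ysX]].
have -> : (\sum_(x <- ys | Q x) deg m x U = \sum_(b <- bs) \sum_(x <- b | Q x) deg m x U)%N.
  by rewrite -fbs big_flatten.
rewrite natr_sum.
apply: (@le_trans _ _ (\sum_(b <- bs) (C1 * t + C1 * Num.sqrt t * n%:R `^ eps * (count Q b)%:R))).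
  by rewrite big_seq [leRHS]big_seq; apply: ler_sum => b /block.
rewrite big_split /=; apply: lerD.
  rewrite big_const_seq count_predT iter_addr_0 -[leLHS]mulr_natr.
  by apply: ler_wpM2l => //; rewrite mulr_ge0 //; lra.
rewrite -big_distrr /= -natr_sum ler_wpM2l //.
  by rewrite !mulr_ge0 ?sqrtr_ge0 ?powR_ge0 //; lra.
rewrite ler_nat.
have -> : (\sum_(b <- bs) count Q b = count Q ys)%N by rewrite -fbs count_flatten sumnE big_map.
rewrite (permP (sweep_perm sw)) count_filter; apply: sub_count => x /=.
by case/andP=> /andP[].
Qed.

End Bounds.

(** * Sampling and the exponent 4/3 *)

Section MainBound.
Variable R : realType.
Local Notation vec := (vec R).
Implicit Types (x y u v a b : vec) (X U S : seq vec).

Lemma ln_le_powR (x a : R) : 0 < x -> 0 < a -> ln x <= x `^ a / a.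
Proof.
move=> x0 a0; rewrite ler_pdivlMr // mulrC.
rewrite /powR gt_eqF //; have := expR_ge1Dx (a * ln x); lra.
Qed.

Lemma powRDgt0 (z a b : R) : 0 < z -> z `^ (a + b) = z `^ a * z `^ b.
Proof. by move=> z0; apply: powRD; rewrite (gt_eqF z0) implybT. Qed.

(** With [y = n^(-1/3)], the bound [1 - y <= exp (- y)] makes the left side at most
    [N / (1 + N)]. *)
Lemma small_tail (n : nat) (N q : nat) : (0 < n)%N ->
  n%:R `^ (1 / 3) * ln (1 + N%:R) < q%:R :> R ->
  N%:R * (1 - n%:R `^ (2 / 3) / n%:R) ^+ q < 1 :> R.
Proof.
move=> n0 hq; set z : R := n%:R in hq *.
have z1 : 1 <= z by rewrite /z ler1n.
have z0 : 0 < z by lra.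
set y := z `^ (2 / 3) / z.
have yz : y * z `^ (1 / 3) = 1.
  rewrite /y mulrAC -powRDgt0 // (_ : 2 / 3 + 1 / 3 = 1); last by field.
  by rewrite powRr1 ?ltW // divff // gt_eqF.
have y0 : 0 < y by rewrite divr_gt0 // powR_gt0.
have y1 : y <= 1.
  rewrite ler_pdivrMr // mul1r -[leRHS](powRr1 (ltW z0)).
  by apply: ler_powR => //; lra.
have N0 : 0 <= N%:R :> R by [].
apply: (@le_lt_trans _ _ (N%:R * expR (- ln (1 + N%:R)))).
  rewrite ler_wpM2l //; apply: (@le_trans _ _ (expR (- y) ^+ q)).
    by rewrite lerXn2r ?nnegrE ?expR_ge0 ?subr_ge0 //; have := expR_ge1Dx (- y); lra.
  rewrite -expRM_natl ler_expR.
  have : y * (z `^ (1 / 3) * ln (1 + N%:R)) <= y * q%:R by rewrite ler_wpM2l // ltW.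
  by rewrite mulrA yz; lra.
rewrite expRN lnK ?posrE; last by lra.
by rewrite ltr_pdivrMr; lra.
Qed.

(** The exponent [e / 5] for the logarithm offsets the fifth power. The [+ 2] pays for rounding up
    the number of greedy steps and for one element that keeps the sample nonempty. *)
Lemma sample_size (e : R) : 0 < e -> exists2 D : R, 1 <= D & forall n : nat, (0 < n)%N ->
  n%:R `^ (1 / 3) * ln (1 + (4 * n ^ 5)%:R) + 2 <= D * n%:R `^ (1 / 3 + e).
Proof.
move=> e0; pose a := e / 5; have a0 : 0 < a by rewrite /a; lra.
pose D0 := 5 `^ a / a; have D00 : 0 <= D0 by rewrite divr_ge0 ?powR_ge0 // ltW.
exists (D0 + 2) => [|n n0]; first by lra.
have z1 : 1 <= n%:R :> R by rewrite ler1n.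
have z0 : 0 < n%:R :> R by lra.
have w1 : 1 <= n%:R `^ (1 / 3 + e) :> R by apply: natpow_ge1 => //; lra.
rewrite mulrDl; apply: lerD; last by lra.
rewrite powRDgt0 // mulrCA ler_wpM2l ?powR_ge0 //.
have N0 : 0 <= (4 * n ^ 5)%:R :> R by [].
apply: le_trans (ln_le_powR _ a0) _; first by lra.
rewrite /D0 mulrAC ler_wpM2r ?invr_ge0 ?(ltW a0) //.
have -> : n%:R `^ e = (n%:R ^+ 5) `^ a :> R.
  by rewrite -powR_mulrn // -powRrM; congr (_ `^ _); rewrite /a; field.
rewrite -powRM ?exprn_ge0 //; apply: ge0_ler_powR; rewrite ?nnegrE ?mulr_ge0 ?exprn_ge0 //.
  exact: ltW.
have : 1 <= n%:R ^+ 5 :> R by rewrite exprn_ege1.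
by rewrite natrM natrX; lra.
Qed.

Lemma sum_partition S X (f : vec -> vec) : uniq S -> {in X, forall x, f x \in S} ->
  forall F : vec -> nat, (\sum_(x <- X) F x = \sum_(u <- S) \sum_(x <- X | f x == u) F x)%N.
Proof.
move=> uS fS F; under [RHS]eq_bigr do rewrite big_mkcond /=.
rewrite exchange_big /= big_seq [RHS]big_seq; apply: eq_bigr => x xX.
rewrite -big_mkcond /= big_const_seq iter_addn_0.
rewrite (eq_count (a2 := pred1 (f x))); last by move=> u; rewrite /= eq_sym.
by rewrite count_uniq_mem // fS // muln1.
Qed.

Lemma box_size n : (n * n * n * (2 * n) * (2 * n) = 4 * n ^ 5)%N.
Proof. by rewrite !expnS expn0; ring. Qed.

(** Here [z] is [n] and [s] the size of the sample. The condition [e <= 1] serves to bound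
    [D^(1 + e)] by [D ^+ 2] and [(1/3 + e) (1 + e)] by [1/3 + 3 e]. *)
Lemma incidence_arith (C0 C1 C2 D e z s : R) :
  1 <= C0 -> 1 <= C1 -> 0 <= C2 -> 1 <= D -> 0 < e -> e <= 1 -> 1 <= z -> 0 <= s ->
  s <= D * z `^ (1 / 3 + e) ->
  s * (C0 * (z + z `^ (1 + e)) + z + C1 * z `^ (2 / 3) * (2 * (C2 * s `^ (1 + e)) + 1))
   + C1 * Num.sqrt (z `^ (2 / 3)) * z `^ e * z <=
  (D * (2 * C0 + 1) + D * C1 * (2 * C2 * D ^+ 2 + 1) + C1) * z `^ (4 / 3 + 4 * e).
Proof.
move=> C01 C11 C20 D1 e0 e1 z1 s0 sD; have z0 : 0 < z by lra.
have C0p : 0 <= C0 by lra.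
have C1p : 0 <= C1 by lra.
have Dp : 0 <= D by lra.
pose t := z `^ (2 / 3); have t0 : 0 <= t by exact: powR_ge0.
pose A := C0 * (z + z `^ (1 + e)) + z + C1 * t * (2 * (C2 * s `^ (1 + e)) + 1).
pose K := C1 * Num.sqrt t * z `^ e.
rewrite -/t -/A -/K.
pose w (r : R) := z `^ r.
have wD r r' : w r * w r' = w (r + r') by rewrite /w powRDgt0.
have wle r r' : r <= r' -> w r <= w r' by move=> h; apply: ler_powR.
have w0 r : 0 <= w r by exact: powR_ge0.
have zw : z = w 1 by rewrite /w powRr1 // ltW.
have sE : s `^ (1 + e) <= D ^+ 2 * w (1 / 3 + 3 * e).
  apply: (@le_trans _ _ ((D * w (1 / 3 + e)) `^ (1 + e))).
    by apply: ge0_ler_powR; rewrite ?nnegrE ?mulr_ge0 //; lra.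
  rewrite powRM //.
  apply: ler_pM; rewrite ?powR_ge0 //.
    rewrite -(@powR_mulrn _ _ 2); last by lra.
    by apply: ler_powR; lra.
  by rewrite /w -powRrM; apply: wle; nra.
have st : Num.sqrt t = w (1 / 3).
  by rewrite /t -powR12_sqrt ?powR_ge0 // -powRrM; congr (_ `^ _); field.
have T1 : s * (C0 * (z + z `^ (1 + e)) + z) <= D * (2 * C0 + 1) * w (4 / 3 + 4 * e).
  apply: (@le_trans _ _ ((D * w (1 / 3 + e)) * ((2 * C0 + 1) * w (1 + e)))).
    apply: ler_pM => //.
      by rewrite addr_ge0 ?mulr_ge0 ?addr_ge0 ?powR_ge0 //; lra.
    have : z <= w (1 + e) by rewrite [leLHS]zw; apply: wle; lra.
    by rewrite -/(w (1 + e)); nra.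
  rewrite (_ : _ * _ = D * (2 * C0 + 1) * (w (1 / 3 + e) * w (1 + e))); last by ring.
  by rewrite wD ler_wpM2l ?wle //; nra.
have T2 : s * (C1 * t * (2 * (C2 * s `^ (1 + e)) + 1)) <=
    D * C1 * (2 * C2 * D ^+ 2 + 1) * w (4 / 3 + 4 * e).
  apply: (@le_trans _ _ ((D * w (1 / 3 + e)) *
      (C1 * w (2 / 3) * ((2 * C2 * D ^+ 2 + 1) * w (1 / 3 + 3 * e))))).
    apply: ler_pM => //.
      by rewrite !mulr_ge0 // addr_ge0 // !mulr_ge0 // powR_ge0.
    apply: ler_wpM2l; first by rewrite mulr_ge0 //; lra.
    have h1 : 1 <= w (1 / 3 + 3 * e) by rewrite -[leLHS](powRr0 z); apply: wle; lra.
    have := ler_wpM2l C20 sE; lra.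
  rewrite (_ : _ * _ = D * C1 * (2 * C2 * D ^+ 2 + 1) *
    (w (1 / 3 + e) * w (2 / 3) * w (1 / 3 + 3 * e))); last by ring.
  rewrite !wD ler_wpM2l ?wle //; last by lra.
  by rewrite !mulr_ge0 ?addr_ge0 ?mulr_ge0 ?exprn_ge0 //; lra.
have T3 : K * z <= C1 * w (4 / 3 + 4 * e).
  rewrite /K st [X in _ * X <= _]zw -/(w e) -!mulrA !wD ler_wpM2l ?wle //; lra.
rewrite -/(w (4 / 3 + 4 * e)) /A mulrDr; lra.
Qed.

Lemma incidence_bound_aux (e : R) : 0 < e -> e <= 1 -> exists2 C : R, 0 <= C &
  forall m X U n, config m X U -> (size X <= n)%N -> (size U <= n)%N ->
    (incidences m X U)%:R <= C * n%:R `^ (4 / 3 + 4 * e).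
Proof.
move=> e0 e1.
have [C0 C01 tieB] := tie_bound e0.
have [C1 C11 pairB] := pair_bound e0.
have [C2 C20 dsB] := @davenport_schinzel R e 60 e0.
have [D D1 HD] := sample_size e0.
have Kp : 0 <= D * (2 * C0 + 1) + D * C1 * (2 * C2 * D ^+ 2 + 1) + C1.
  by rewrite !addr_ge0 ?mulr_ge0 ?addr_ge0 ?mulr_ge0 ?exprn_ge0 // (le_trans ler01).
exists (D * (2 * C0 + 1) + D * C1 * (2 * C2 * D ^+ 2 + 1) + C1).
  exact: Kp.
move=> m X U n cf sX sU.
case: n sX sU => [|n'] sX sU.
  case: X sX cf => // _ _; rewrite /incidences big_nil mulr_ge0 ?powR_ge0 //.
set n := n'.+1 in sX sU *; have n0 : (0 < n)%N by [].
have [U0|Un] := eqVneq U [::].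
  rewrite incidencesC U0 /incidences big_nil mulr_ge0 ?powR_ge0 //.
set z : R := n%:R; have z1 : 1 <= z by rewrite /z ler1n.
have z0 : 0 < z by lra.
pose t := z `^ (2 / 3); have t0 : 0 < t by rewrite powR_gt0.
have tz : t <= z.
  by rewrite -[leRHS](powRr1 (ltW z0)); apply: ler_powR => //; lra.
have [sw Hsw] : {sw : vec -> seq vec * (bool -> vec -> vec -> vec -> bool) *
    (bool -> vec -> vec -> bool) * (bool -> vec -> vec -> bool) &
    forall u0, sweep X u0 (sw u0).1.1.1 (sw u0).1.1.2 (sw u0).1.2 (sw u0).2}.
  apply: (@choice _ _ (fun u0 (d : seq vec * (bool -> vec -> vec -> vec -> bool) *
    (bool -> vec -> vec -> bool) * (bool -> vec -> vec -> bool)) =>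
    sweep X u0 d.1.1.1 d.1.1.2 d.1.2 d.2)) => u0; have [ys [ge [ins [on H]]]] := sweepP X u0.
  by exists (ys, ge, ins, on).
pose rng (j : vec * vec * vec * nat * nat) :=
  conflict (sw j.1.1.1.1).1.1.1 (sw j.1.1.1.1).1.2 j.1.1.1.1 j.1.1.1.2 j.1.1.2 j.1.2 j.2.
pose I := iota 0 (size X).+1.
pose js := [seq (p, l) | p <- [seq (p, i) | p <- [seq (p, u2) |
   p <- [seq (u0, u1) | u0 <- U, u1 <- U], u2 <- U], i <- I], l <- I].
pose Js := [seq j <- js | t <= (count (rng j) U)%:R].
have sJs : (size Js <= 4 * n ^ 5)%N.
  apply: (@leq_trans (size js)); first by rewrite size_filter count_size.
  rewrite !size_allpairs size_iota.
  apply: (@leq_trans (n * n * n * (2 * n) * (2 * n))).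
    have sX2 : ((size X).+1 <= 2 * n)%N.
      by rewrite mul2n -addnn -addn1 leq_add.
    by rewrite !leq_mul.
  exact: eq_leq (box_size n).
pose q := (Num.truncn (z `^ (1 / 3) * ln (1 + (4 * n ^ 5)%:R))).+1.
have HJ : {in Js, forall j, t <= (count (rng j) U)%:R}.
  by move=> j; rewrite mem_filter => /andP[].
have sU' : (size U)%:R <= z by rewrite ler_nat.
have [S' [S'U sS' cS']] := @hitting_set R _ _ U Js rng t z q t0 sU' tz HJ.
have LN : 0 <= z `^ (1 / 3) * ln (1 + (4 * n ^ 5)%:R).
  by rewrite mulr_ge0 ?powR_ge0 // ln_ge0 // lerDl.
have /andP[q1 q2] := truncn_itv LN.
(* The number of descriptions with long lists that the sample misses is below 1, hence 0. *)
have unhit : (count (fun j => ~~ has (rng j) S') Js = 0)%N.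
  apply/eqP; rewrite -leqn0 -ltnS -(ltr_nat R); apply: (le_lt_trans cS').
  apply: le_lt_trans (small_tail n0 q2); rewrite ler_wpM2r ?ler_nat //.
  by rewrite exprn_ge0 // subr_ge0 ler_pdivrMr // mul1r.
have [v vU] : exists v, v \in U by case: (U) Un => // v U' _; exists v; rewrite mem_head.
pose S := undup (v :: S').
have uS : uniq S by exact: undup_uniq.
have SU : {subset S <= U}.
  by move=> u; rewrite mem_undup inE => /predU1P[->//|/S'U].
have Sn : S != [::].
  by apply/eqP => S0; have := mem_undup (v :: S') v; rewrite -/S S0 mem_head.
set s : R := (size S)%:R.
have sD : s <= D * z `^ (1 / 3 + e).
  apply: le_trans (HD n n0); apply: (@le_trans _ _ ((size S').+1)%:R).
    by rewrite ler_nat; exact: size_undup.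
  apply: (@le_trans _ _ q.+1%:R); first by rewrite ler_nat ltnS.
  by rewrite /q -addn2 natrD lerD2r.
pose g a b x := nn x b <= nn x a.
have gtot a b x : g a b x || g b a x by exact: le_total.
have gtr a b c x : g a b x -> g b c x -> g a c x by move=> h1 h2; apply: le_trans h1.
pose f := best g S v.
have fS : {in X, forall x, f x \in S} by move=> x _; apply: best_mem.
pose A := C0 * (z + z `^ (1 + e)) + z + C1 * t * (2 * (C2 * s `^ (1 + e)) + 1).
pose K := C1 * Num.sqrt t * z `^ e.
have per u0 : u0 \in S -> (\sum_(x <- X | f x == u0) deg m x U)%:R <=
    A + K * (count (fun x => f x == u0) X)%:R.
  move=> u0S.
  apply: (@center_bound R e C0 C1 C2 m X U S n t u0 _ _ _ _ (fun x => f x == u0)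
    e0 C01 C11 C20 tieB pairB dsB cf sX sU (ltW t0) uS SU u0S (Hsw u0)).
    move=> x xX /eqP fx u uS'; have := best_max gtot gtr v x uS'.
    by rewrite -/f -/(f x) fx.
  move=> u1 u2 i l u1U u2U iX lX nh; apply: ltW; rewrite ltNge; apply/negP => ht.
  pose j := (u0, u1, u2, i, l).
  have jJ : j \in Js.
    rewrite mem_filter; apply/andP; split; first exact: ht.
    by rewrite !allpairs_f ?mem_iota // SU.
  have /eqP := unhit; rewrite eqn0Ngt -has_count => /hasPn/(_ j jJ).
  rewrite negbK => /hasP[u uS' ru]; move/hasPn: nh => /(_ u).
  by rewrite mem_undup inE uS' orbT => /(_ isT)/negP; apply; exact: ru.
(* The classes of [f] partition [X], so the square-root term is paid once for all of [X] and not
   once per sampled axis. *)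
have tot : (incidences m X U)%:R <= s * A + K * z.
  rewrite /incidences (sum_partition uS fS) natr_sum.
  apply: (@le_trans _ _ (\sum_(u <- S) (A + K * (count (fun x => f x == u) X)%:R))).
    by rewrite big_seq [leRHS]big_seq; apply: ler_sum.
  rewrite big_split /=; apply: lerD.
    by rewrite big_const_seq count_predT iter_addr_0 -[leLHS]mulr_natl.
  rewrite -big_distrr /= ler_wpM2l //.
    by rewrite !mulr_ge0 ?sqrtr_ge0 ?powR_ge0 // (le_trans ler01).
  rewrite -natr_sum ler_nat; apply: leq_trans sX.
  rewrite -[size X]sum1_size (sum_partition uS fS (fun _ => 1%N)).
  by apply: leq_sum => u _; rewrite sum1_count.
exact: le_trans tot (incidence_arith C01 C11 C20 D1 e0 e1 z1 _ sD).
Qed.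

Theorem incidence_bound (eps : R) : 0 < eps -> exists2 C : R, 0 <= C &
  forall m X U n, config m X U -> (size X <= n)%N -> (size U <= n)%N ->
    (incidences m X U)%:R <= C * n%:R `^ (4 / 3 + eps).
Proof.
move=> e0; pose e := Num.min 1 (eps / 4).
have ee0 : 0 < e by rewrite /e lt_min; apply/andP; split; lra.
have e1 : e <= 1 by rewrite /e ge_min lexx.
have e4' : e <= eps / 4 by rewrite /e ge_min lexx orbT.
have e4 : 4 * e <= eps by lra.
have [C C0 HC] := incidence_bound_aux ee0 e1.
exists C => // m X U n cf sX sU; apply: le_trans (HC _ _ _ _ cf sX sU) _.
rewrite ler_wpM2l //; case: n {sX sU} => [|n].
  by rewrite !powR0 ?gt_eqF //; lra.
by apply: ler_powR; rewrite ?ler1n // lerD2l.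
Qed.

End MainBound.

(** * Upper bound *)

Section Upper.
Variable R : realType.
Local Notation vec := (vec R).
Implicit Types (a b c p : 'rV[R]_3) (x y u : vec).

Definition tov a : vec := (a 0 0, a 0 1, a 0 2).

Lemma tov_inj : injective tov.
Proof.
move=> a b [h0 h1 h2]; apply/rowP => -[[|[|[|//]]] hi].
- by rewrite (_ : Ordinal hi = 0) //; apply: val_inj.
- by rewrite (_ : Ordinal hi = 1) //; apply: val_inj.
- by rewrite (_ : Ordinal hi = 2) //; apply: val_inj.
Qed.

Lemma sum_I3 (F : 'I_3 -> R) : \sum_i F i = F 0 + F 1 + F 2.
Proof.
rewrite !big_ord_recl big_ord0 addr0 addrA.
by congr (F _ + F _ + F _); apply: val_inj.
Qed.

Lemma tov_crossmul a b : tov (crossmul a b) = cross (tov a) (tov b).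
Proof.
have i1 : 0 + 1 = 1 :> 'I_3 by apply: val_inj.
have i2 : 0 + 2 = 2 :> 'I_3 by apply: val_inj.
have i3 : 1 + 1 = 2 :> 'I_3 by apply: val_inj.
have i4 : 1 + 2 = 0 :> 'I_3 by apply: val_inj.
have i5 : 2 + 1 = 0 :> 'I_3 by apply: val_inj.
have i6 : 2 + 2 = 1 :> 'I_3 by apply: val_inj.
by rewrite /tov /cross /=; congr (_, _, _); rewrite mxE ?i1 ?i2 ?i3 ?i4 ?i5 ?i6.
Qed.

Lemma norm2E a : norm2 a = Num.sqrt (dot (tov a) (tov a)).
Proof. by rewrite /norm2 sum_I3 /dot /= !expr2. Qed.

Lemma areaE a b c : area a b c = Num.sqrt (nn (tov (b - a)) (tov (c - a))) / 2.
Proof. by rewrite /area norm2E tov_crossmul. Qed.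

Lemma proportional x y : dot x x != 0 -> nn x y = 0 ->
  y = (dot x y / dot x x * x.1.1, dot x y / dot x x * x.1.2, dot x y / dot x x * x.2).
Proof.
move=> x0; rewrite nnC => /dot_eq0; rewrite /cross /= => -[h1 h2 h3].
have f q q' : dot x x * q = dot x y * q' -> q = dot x y / dot x x * q'.
  by move=> h; rewrite mulrAC -h mulrAC divff // mul1r.
case: y f h1 h2 h3 => [[y1 y2] y3] f /= h1 h2 h3; congr (_, _, _); apply: f.
- apply/eqP; rewrite -subr_eq0; apply/eqP.
  transitivity (x.1.2 * (y1 * x.1.2 - y2 * x.1.1) - x.2 * (y3 * x.1.1 - y1 * x.2)).
    by rewrite /dot /=; ring.
  by rewrite h2 h3; ring.
- apply/eqP; rewrite -subr_eq0; apply/eqP.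
  transitivity (x.2 * (y2 * x.2 - y3 * x.1.2) - x.1.1 * (y1 * x.1.2 - y2 * x.1.1)).
    by rewrite /dot /=; ring.
  by rewrite h1 h3; ring.
- apply/eqP; rewrite -subr_eq0; apply/eqP.
  transitivity (x.1.1 * (y3 * x.1.1 - y1 * x.2) - x.1.2 * (y2 * x.2 - y3 * x.1.2)).
    by rewrite /dot /=; ring.
  by rewrite h1 h2; ring.
Qed.

Lemma collinear_nn0 a b c : collinear [fset a; b; c] ->
  nn (tov (b - a)) (tov (c - a)) = 0.
Proof.
case=> p [v H].
have [ta ->] := H a ltac:(by rewrite !inE eqxx).
have [tb ->] := H b ltac:(by rewrite !inE eqxx ?orbT).
have [tc ->] := H c ltac:(by rewrite !inE eqxx ?orbT).
by rewrite /nn /dot /cross /tov /= !mxE; ring.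
Qed.

Lemma nn0_collinear a b c : nn (tov (b - a)) (tov (c - a)) = 0 ->
  collinear [fset a; b; c].
Proof.
have [ba|ba] := eqVneq (dot (tov (b - a)) (tov (b - a))) 0 => h.
  have {}ba : b = a.
    apply/eqP; rewrite -subr_eq0; apply/eqP/tov_inj.
    have [h1 h2 h3] := dot_eq0 ba; move: h1 h2 h3; rewrite /tov /= => -> -> ->.
    by rewrite !mxE.
  exists a, (c - a) => x; rewrite !inE => /orP[/orP[]|]/eqP ->.
  - by exists 0; rewrite scale0r addr0.
  - by exists 0; rewrite scale0r addr0.
  - by exists 1; rewrite scale1r addrC subrK.
have := proportional ba h; set l := _ / _ => e.
exists a, (b - a) => x; rewrite !inE => /orP[/orP[]|]/eqP ->.
- by exists 0; rewrite scale0r addr0.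
- by exists 1; rewrite scale1r addrC subrK.
- exists l; apply/eqP; rewrite addrC -subr_eq; apply/eqP/tov_inj.
  by rewrite e /tov /= !mxE.
Qed.

(** Lexicographic positivity, selecting one vector of each antipodal pair. *)
Definition vpos x := (0 < x.1.1) ||
  ((x.1.1 == 0) && ((0 < x.1.2) || ((x.1.2 == 0) && (0 < x.2)))).

Lemma vposN x : dot x x != 0 -> vpos (-1 * x.1.1, -1 * x.1.2, -1 * x.2) = ~~ vpos x.
Proof.
case: x => [[x1 x2] x3]; rewrite /vpos /dot /= !mulN1r !oppr_eq0 !oppr_gt0.
case: (ltgtP x1 0) => //= ->; case: (ltgtP x2 0) => //= ->; case: (ltgtP x3 0) => //= ->.
by rewrite !mulr0 !addr0 eqxx.
Qed.

(** Parallel vectors are excluded in [config]. If [y = l x] and both have an incidence, then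
    [l ^+ 2 = 1], as neither may exceed [m]; so only antipodal pairs occur, and [vpos] separates
    them. The four pairs of halves give [4 * C]. *)
Lemma sym_incidence_bound (eps : R) : 0 < eps -> exists2 C : R, 0 <= C &
  forall m (V : seq vec), 0 < m -> uniq V -> {in V &, forall x u, nn x u <= m} ->
    (incidences m V V)%:R <= C * (size V)%:R `^ (4 / 3 + eps).
Proof.
move=> e0; have [C C0 HC] := @incidence_bound R eps e0.
exists (4 * C) => [|m V m0 uV Vm]; first by rewrite mulr_ge0.
pose V' s := [seq x <- V | (vpos x == s) && has (fun u => nn x u == m) V].
have cf s s' : config m (V' s) (V' s').
  have nz x : has (fun u => nn x u == m) V -> dot x x != 0.
    move=> /hasP[u _ /eqP xu]; apply/eqP => /dot_eq0[h1 h2 h3].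
    by move: m0; rewrite -xu /nn /dot /cross /= h1 h2 h3 !(mul0r, mulr0, subr0, addr0) ltxx.
  have par r : {in V' r &, forall x y, x != y -> nn x y != 0}.
    move=> x y; rewrite !mem_filter => /andP[/andP[/eqP px hx] xV] /andP[/andP[/eqP py hy] yV].
    apply: contraNneq => xy0; have := proportional (nz _ hx) xy0; set l := _ / _ => ey.
    case/hasP: (hx) => u uinV /eqP xu; case/hasP: (hy) => u' u'V /eqP yu'.
    have sc w : nn y w = l ^+ 2 * nn x w by rewrite ey /nn /dot /cross /=; ring.
    have l1 : l ^+ 2 <= 1.
      have := Vm _ _ yV uinV; rewrite sc xu; nra.
    have l2 : 1 <= l ^+ 2.
      have := Vm _ _ xV u'V; have := sc u'; rewrite yu'; have := sqr_ge0 l; nra.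
    have /eqP : l ^+ 2 = 1 by apply/le_anti/andP.
    rewrite sqrf_eq1 => /orP[]/eqP l'.
      by rewrite ey l' !mul1r; case: (x) => [[]].
    by move: py; rewrite ey l' vposN ?nz // px; case: (r).
  split=> //; rewrite ?filter_uniq //.
  - by move=> x; rewrite mem_filter => /andP[/andP[_ /nz]].
  - by move=> x; rewrite mem_filter => /andP[/andP[_ /nz]].
  - by move=> x u; rewrite !mem_filter => /andP[_ xV] /andP[_ uinV]; apply: Vm.
have szV' s : (size (V' s) <= size V)%N by rewrite size_filter count_size.
have split : incidences m V V = (incidences m (V' true) (V' true)
   + incidences m (V' true) (V' false) + incidences m (V' false) (V' true)
   + incidences m (V' false) (V' false))%N.
  have degE x : x \in V -> deg m x V = (deg m x (V' true) + deg m x (V' false))%N.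
    move=> xV; rewrite /deg !count_filter -(count_predUI) [X in (_ + X)%N](_ : _ = 0)%N ?addn0.
      apply: eq_in_count => u _ /=; case: (nn x u =P m) => //= xu.
      have -> : has (fun v => nn u v == m) V by apply/hasP; exists x => //; rewrite nnC xu.
      by rewrite !andbT; case: (vpos u).
    by apply/eqP; rewrite -leqn0 leqNgt -has_count -all_predC; apply/allP => u _ /=;
      case: (vpos u); rewrite /= ?andbF.
  have sumE (F : vec -> nat) : (forall x, x \in V -> ~~ has (fun u => nn x u == m) V -> F x = 0)%N ->
      (\sum_(x <- V) F x = \sum_(x <- V' true) F x + \sum_(x <- V' false) F x)%N.
    move=> F0; rewrite /V' !big_filter (bigID (fun x => has (fun u => nn x u == m) V)) /=.
    rewrite [X in (_ + X)%N]big_seq_cond [X in (_ + X)%N]big1 ?addn0; last first.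
      by move=> x /andP[xV]; exact: F0.
    rewrite (bigID vpos) /=; congr (_ + _)%N; apply: eq_bigl => x; rewrite andbC //.
      by rewrite eqb_id.
    by rewrite eqbF_neg.
  rewrite /incidences big_seq (eq_bigr _ degE) -big_seq sumE.
    by rewrite !big_split /= -!addnA.
  move=> x xV nh; rewrite -degE //; apply/eqP; rewrite -leqn0 leqNgt -has_count.
  exact: nh.
rewrite split !natrD.
have h s s' := HC _ _ _ _ (cf s s') (szV' s) (szV' s').
have := h true true; have := h true false; have := h false true; have := h false false.
by lra.
Qed.

Lemma size_incidences m (X U : seq vec) :
  size [seq q <- [seq (x, u) | x <- X, u <- U] | nn q.1 q.2 == m] = incidences m X U.
Proof.
rewrite size_filter /incidences; elim: X => [|x X IH]; first by rewrite big_nil.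
by rewrite big_cons allpairs_cons count_cat -IH count_map.
Qed.

Lemma nn_area a b c : nn (tov (b - a)) (tov (c - a)) = (2 * area a b c) ^+ 2.
Proof.
rewrite areaE (_ : 2 * _ = Num.sqrt (nn (tov (b - a)) (tov (c - a)))); last by field.
by rewrite sqr_sqrtr // nn_ge0.
Qed.

Lemma trianglesP (P : {fset 'rV[R]_3}) T : T \in triangles P -> exists a b c,
  [/\ enum_fset T = [:: a; b; c], [/\ a \in P, b \in P & c \in P] &
      nn (tov (b - a)) (tov (c - a)) != 0].
Proof.
rewrite !inE /= => /and3P[TPm /eqP T3 nc].
have /fsubsetP TP : T `<=` P by rewrite -fpowersetE; exact: TPm.
case eT: (enum_fset T) => [|a [|b [|c [|]]]]; move: (T3); rewrite /= eT // => _.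
have TE : T = [fset a; b; c].
  by apply/fsetP => x; rewrite -[x \in T]/(x \in enum_fset T) eT !inE orbA.
exists a, b, c; split=> //.
  by split; apply: TP; rewrite TE !inE eqxx ?orbT.
apply: contra nc => /eqP h; apply/asboolP; rewrite TE; exact: nn0_collinear.
Qed.

Lemma triangles3 (P : {fset 'rV[R]_3}) a b c : a \in P -> b \in P -> c \in P ->
  nn (tov (b - a)) (tov (c - a)) != 0 ->
  [fset a; b; c] \in triangles P /\ tri_area [fset a; b; c] = area a b c.
Proof.
move=> aP bP cP n0.
have ab : a != b.
  by apply: contraNneq n0 => ->; rewrite /nn /dot /cross /tov /= !mxE; apply/eqP; ring.
have ac : a != c.
  by apply: contraNneq n0 => ->; rewrite /nn /dot /cross /tov /= !mxE; apply/eqP; ring.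
have bc : b != c.
  by apply: contraNneq n0 => ->; rewrite /nn /dot /cross /tov /= !mxE; apply/eqP; ring.
have u3 : uniq [:: a; b; c] by rewrite /= !inE negb_or ab ac bc.
split; last exact: tri_areaE.
rewrite !inE /=; apply/and3P; split.
- suff : [fset a; b; c] \in fpowerset P by [].
  by rewrite fpowersetE; apply/fsubsetP => x; rewrite !inE => /orP[/orP[]|]/eqP ->.
- apply/eqP; rewrite (@perm_size _ _ [:: a; b; c]) //.
  apply: uniq_perm => //; first exact: fset_uniq.
  by move=> x; rewrite -[x \in enum_fset _]/(x \in [fset a; b; c]) !inE orbA.
- by apply: contra n0 => /asboolP /collinear_nn0 ->.
Qed.

(** A triangle is charged once, at the vertex its set enumerates first, to the incidence between the
    two edge vectors from there; the sum over [n] vertices adds 1 to the exponent. *)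
Lemma max_area_upper (eps : R) : 0 < eps -> exists C : R,
  forall (n : nat) (P : {fset 'rV[R]_3}), #|` P| = n ->
    #|` max_area_triangles P|%:R <= C * n%:R `^ (7 / 3 + eps).
Proof.
move=> e0; have [C C0 HC] := sym_incidence_bound e0.
exists C => n P sP; set M := max_area_triangles P.
have [->|[T0 T0M]] := fset_0Vmem M.
  by rewrite cardfs0 mulr_ge0 ?powR_ge0.
have ME T : T \in M -> T \in triangles P /\
    forall T', T' \in triangles P -> tri_area T' <= tri_area T.
  by rewrite inE /= => /andP[TT /asboolP].
pose m := (2 * tri_area T0) ^+ 2.
have [T0t T0max] := ME _ T0M.
have Mm T a b c : T \in M -> enum_fset T = [:: a; b; c] ->
    nn (tov (b - a)) (tov (c - a)) = m.
  move=> /ME[Tt Tmax] eT; rewrite nn_area /m; congr ((2 * _) ^+ 2).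
  have <- : tri_area T = area a b c by rewrite /tri_area eT.
  by apply/le_anti; rewrite T0max // Tmax.
have m0 : 0 < m.
  have [a [b [c [eT _ n0]]]] := trianglesP T0t.
  by rewrite -(Mm _ _ _ _ T0M eT) nn_gt0.
have area0 a b c : 0 <= area a b c by rewrite areaE divr_ge0 // sqrtr_ge0.
have le_m a b c : a \in P -> b \in P -> c \in P -> nn (tov (b - a)) (tov (c - a)) <= m.
  move=> aP bP cP.
  have [->|n0] := eqVneq (nn (tov (b - a)) (tov (c - a))) 0; first exact: ltW.
  have [Tt Ta] := triangles3 aP bP cP n0.
  have := T0max _ Tt; rewrite Ta nn_area /m => h.
  by apply: lerXn2r; rewrite ?nnegrE; have := area0 a b c; lra.
pose V a := [seq tov (b - a) | b <- enum_fset P].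
have sV a : size (V a) = n by rewrite size_map.
have uV a : uniq (V a).
  by rewrite map_inj_uniq ?fset_uniq // => b c /tov_inj /addIr.
have Vm a : a \in P -> {in V a &, forall x u, nn x u <= m}.
  by move=> aP x u /mapP[b bP ->] /mapP[c cP ->]; apply: le_m.
pose L a := [seq q <- [seq (x, u) | x <- V a, u <- V a] | nn q.1 q.2 == m].
have sL a : size (L a) = incidences m (V a) (V a).
  exact: size_incidences.
pose F (T : {fset 'rV[R]_3}) := let s := enum_fset T in
  (s`_0, (tov (s`_1 - s`_0), tov (s`_2 - s`_0))).
have : (#|` M| <= size (flatten [seq [seq (a, q) | q <- L a] | a <- enum_fset P]))%N.
  rewrite -(size_map F); apply: uniq_leq_size.
    rewrite map_inj_in_uniq ?fset_uniq // => T T' /ME[Tt _] /ME[T't _].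
    have [a [b [c [eT _ _]]]] := trianglesP Tt.
    have [a' [b' [c' [eT' _ _]]]] := trianglesP T't.
    rewrite /F eT eT' /= => e.
    have ea : a = a' := congr1 fst e.
    have eb := congr1 (fun z => z.2.1) e; have ec := congr1 (fun z => z.2.2) e.
    move: eb ec; rewrite /= ea => /tov_inj/addIr eb /tov_inj/addIr ec.
    apply/fsetP => x; rewrite -[x \in T]/(x \in enum_fset T) eT.
    by rewrite -[x \in T']/(x \in enum_fset T') eT' ea eb ec.
  move=> z /mapP[T TM ->].
  have [a [b [c [eT [aP bP cP] _]]]] := trianglesP (ME _ TM).1.
  rewrite /F eT /=; apply/flatten_mapP; exists a => //; apply: map_f.
  rewrite mem_filter /= (Mm _ _ _ _ TM eT) eqxx /=.
  by apply: allpairs_f; apply: map_f.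
rewrite size_flatten /shape -map_comp sumnE big_map => h.
apply: (@le_trans _ _ (\sum_(a <- enum_fset P) (incidences m (V a) (V a))%:R)).
  rewrite -natr_sum ler_nat (leq_trans h) //; apply: eq_leq; apply: eq_bigr => a _.
  by rewrite /= size_map sL.
apply: (@le_trans _ _ (\sum_(a <- enum_fset P) C * n%:R `^ (4 / 3 + eps))).
  rewrite big_seq [leRHS]big_seq; apply: ler_sum => a aP.
  by apply: le_trans (HC _ _ m0 (uV a) (Vm a aP)) _; rewrite sV.
rewrite big_const_seq count_predT iter_addr_0 -[leLHS]mulr_natr -mulrA ler_wpM2l //.
rewrite [size _]sP -[X in _ * X <= _]powRr1 // -powRD; last by rewrite gt_eqF //; lra.
by rewrite (_ : 4 / 3 + eps + 1 = 7 / 3 + eps) //; field.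
Qed.

End Upper.

(** * Lower bound *)

Section Lower.
Variable R : realType.
Local Notation vec := (vec R).
Implicit Types (x y u v p q r : vec).

Definition vsub x y : vec := (x.1.1 - y.1.1, x.1.2 - y.1.2, x.2 - y.2).
Definition vscale (l : R) x : vec := (l * x.1.1, l * x.1.2, l * x.2).

Definition tor x : 'rV[R]_3 :=
  \row_i (if val i == 0%N then x.1.1 else if val i == 1%N then x.1.2 else x.2).

Lemma torK : cancel tor (@tov R).
Proof. by case=> [[x1 x2] x3]; rewrite /tov !mxE. Qed.

Lemma tovB x y : tov (tor x - tor y) = vsub x y.
Proof. by rewrite -{2}(torK x) -{2}(torK y) /tov /vsub /= !mxE. Qed.

Lemma nn_le_dot x y : nn x y <= dot x x * dot y y.
Proof.
have -> : nn x y = dot x x * dot y y - dot x y ^+ 2.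
  by rewrite /nn /dot /cross /=; ring.
by rewrite lerBlDr lerDl sqr_ge0.
Qed.

Definition near1 v := (dot v v == 1) && (97 / 100 <= v.1.1).
Definition near2 v := (dot v v == 1) && (97 / 100 <= v.1.2).

(** Parallelogram law: [|q - p|^2 = 4 - |p + q|^2], and [|p + q|^2 >= 4 (p1 + q1) - 4 >= 3.76]; this
    is where [97 / 100] suffices. *)
Lemma near1_dist p q : near1 p -> near1 q -> dot (vsub q p) (vsub q p) <= 1 / 4.
Proof.
case: p q => [[p1 p2] p3] [[q1 q2] q3]; rewrite /near1 /dot /vsub /=.
move=> /andP[/eqP hp hp1] /andP[/eqP hq hq1].
have := sqr_ge0 (p2 + q2); have := sqr_ge0 (p3 + q3); have := sqr_ge0 (p1 + q1 - 2).
by rewrite !expr2; nra.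
Qed.

Lemma near2_dist p q : near2 p -> near2 q -> dot (vsub q p) (vsub q p) <= 1 / 4.
Proof.
case: p q => [[p1 p2] p3] [[q1 q2] q3]; rewrite /near2 /dot /vsub /=.
move=> /andP[/eqP hp hp1] /andP[/eqP hq hq1].
have := sqr_ge0 (p1 + q1); have := sqr_ge0 (p3 + q3); have := sqr_ge0 (p2 + q2 - 2).
by rewrite !expr2; nra.
Qed.

Lemma unit_dist p q : dot p p = 1 -> dot q q = 1 -> dot (vsub q p) (vsub q p) <= 4.
Proof.
case: p q => [[p1 p2] p3] [[q1 q2] q3]; rewrite /dot /vsub /= => hp hq.
have := sqr_ge0 (p1 + q1); have := sqr_ge0 (p2 + q2); have := sqr_ge0 (p3 + q3).
by rewrite !expr2; nra.
Qed.

Definition cluster v := [|| v == (0, 0, 0), near1 v | near2 v].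

Lemma nn_sub_rot p q r : nn (vsub q p) (vsub r p) = nn (vsub r q) (vsub p q).
Proof. by rewrite /nn /dot /cross /vsub /=; ring. Qed.

(** With the origin as a vertex, two unit sides bound the product. Otherwise two vertices share a
    cluster, and a side of squared length at most [1 / 4] meets one of at most 4. Rotations and
    swaps of the vertices reduce to these cases. *)
Lemma cluster_nn p q r : cluster p -> cluster q -> cluster r ->
  nn (vsub q p) (vsub r p) <= 1.
Proof.
have unit v : near1 v || near2 v -> dot v v = 1 by case/orP=> /andP[/eqP].
have z0 v : vsub v (0, 0, 0) = v.
  by case: v => [[v1 v2] v3]; rewrite /vsub /= !subr0.
have zero q' r' : cluster q' -> cluster r' -> nn (vsub q' (0, 0, 0)) (vsub r' (0, 0, 0)) <= 1.
  move=> /orP[/eqP->|uq] /orP[/eqP->|ur]; rewrite !z0;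
    try by rewrite /nn /dot /cross /= !(mul0r, mulr0, subr0, addr0) ler01.
  by apply: le_trans (nn_le_dot _ _) _; rewrite !unit // mulr1.
have close p' q' r' : near1 p' && near1 q' || near2 p' && near2 q' ->
    near1 r' || near2 r' -> nn (vsub q' p') (vsub r' p') <= 1.
  move=> h hr; apply: le_trans (nn_le_dot _ _) _.
  have d1 : dot (vsub q' p') (vsub q' p') <= 1 / 4.
    by case/orP: h => /andP[]; [exact: near1_dist | exact: near2_dist].
  have d2 : dot (vsub r' p') (vsub r' p') <= 4.
    by apply: unit_dist; apply: unit => //; case/orP: h => /andP[-> _]; rewrite ?orbT.
  have := dot_ge0 (vsub q' p'); have := dot_ge0 (vsub r' p'); nra.
case/orP=> [/eqP->|up]; first exact: zero.
move=> cq; case/orP: (cq) => [/eqP->|uq cr]; first by move=> cr; rewrite nn_sub_rot zero // /cluster up orbT.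
case/orP: cr => [/eqP->|ur].
  by rewrite nn_sub_rot nn_sub_rot zero // /cluster ?up ?uq orbT.
case/orP: up => np; case/orP: uq => nq; case/orP: ur => nr.
- by apply: close; rewrite ?np ?nq ?nr.
- by apply: close; rewrite ?np ?nq ?nr ?orbT.
- by rewrite nnC; apply: close; rewrite ?np ?nq ?nr ?orbT.
- by rewrite nn_sub_rot; apply: close; rewrite ?np ?nq ?nr ?orbT.
- by rewrite nn_sub_rot; apply: close; rewrite ?np ?nq ?nr ?orbT.
- by rewrite nnC; apply: close; rewrite ?np ?nq ?nr ?orbT.
- by apply: close; rewrite ?np ?nq ?nr ?orbT.
- by apply: close; rewrite ?np ?nq ?nr ?orbT.
Qed.

Definition normalize v := vscale (Num.sqrt (dot v v))^-1 v.

Lemma dot_normalize u v : dot (normalize u) (normalize v) =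
  (Num.sqrt (dot u u))^-1 * (Num.sqrt (dot v v))^-1 * dot u v.
Proof. by rewrite /normalize /vscale /dot /=; ring. Qed.

Lemma normalize_unit v : 0 < dot v v -> dot (normalize v) (normalize v) = 1.
Proof.
move=> v0; rewrite dot_normalize -{3}(sqr_sqrtr (ltW v0)) expr2.
by field; rewrite gt_eqF // sqrtr_gt0.
Qed.

Lemma inv_sqrt_close (w : R) : 1 <= w -> w <= 101 / 100 -> 97 / 100 <= (Num.sqrt w)^-1.
Proof.
move=> w1 w2; have s1 : 1 <= Num.sqrt w by rewrite -sqrtr1 ler_wsqrtr.
have sw := sqr_sqrtr (le_trans ler01 w1).
rewrite -[leLHS]invrK lef_pV2 ?posrE; [|lra|lra].
by apply: (@le_trans _ _ (101 / 100)); [nra | rewrite invf_div; lra].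
Qed.

(** The product of [dirA d s t] and [dirB d s' t'] is [d^2 (s - s' - t t')]: it vanishes exactly
    when the point [(t, s)] is on the line of slope [t'] and intercept [s'] (for nonzero [d]). The
    weights [d^2] and [d] preserve this equation while pulling the vectors towards the axes. *)
Definition dirA (d s t : R) : vec := (1, d ^+ 2 * s, d * t).
Definition dirB (d s t : R) : vec := (- (d ^+ 2 * s), 1, - (d * t)).

Section Directions.
Variables (d s t : R).
Hypotheses (hs : (d ^+ 2 * s) ^+ 2 <= 1 / 200) (ht : (d * t) ^+ 2 <= 1 / 200).

Lemma dirA_dot : 1 <= dot (dirA d s t) (dirA d s t) <= 101 / 100.
Proof.
have -> : dot (dirA d s t) (dirA d s t) = 1 + (d ^+ 2 * s) ^+ 2 + (d * t) ^+ 2.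
  by rewrite /dot /dirA /=; ring.
have := sqr_ge0 (d ^+ 2 * s); have := sqr_ge0 (d * t).
by move: hs ht => ? ? ? ?; apply/andP; split; lra.
Qed.

Lemma dirB_dot : 1 <= dot (dirB d s t) (dirB d s t) <= 101 / 100.
Proof.
have -> : dot (dirB d s t) (dirB d s t) = 1 + (d ^+ 2 * s) ^+ 2 + (d * t) ^+ 2.
  by rewrite /dot /dirB /=; ring.
have := sqr_ge0 (d ^+ 2 * s); have := sqr_ge0 (d * t).
by move: hs ht => ? ? ? ?; apply/andP; split; lra.
Qed.

Lemma dirA_near : near1 (normalize (dirA d s t)).
Proof.
have /andP[h1 h2] := dirA_dot; apply/andP; split.
  by rewrite normalize_unit // (lt_le_trans ltr01).
by rewrite /normalize /vscale /= mulr1 inv_sqrt_close.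
Qed.

Lemma dirB_near : near2 (normalize (dirB d s t)).
Proof.
have /andP[h1 h2] := dirB_dot; apply/andP; split.
  by rewrite normalize_unit // (lt_le_trans ltr01).
by rewrite /normalize /vscale /= mulr1 inv_sqrt_close.
Qed.

End Directions.

Lemma near12_neq u v : near1 u -> near2 v -> u != v.
Proof.
move=> /andP[/eqP du u1] /andP[_ v2]; apply/eqP => e; move: v2; rewrite -e.
case: u du u1 {e} => [[u1 u2] u3]; rewrite /dot /= => h h1 h2; nra.
Qed.

Lemma near_neq0 v : near1 v || near2 v -> v != (0, 0, 0).
Proof.
move=> h; apply/eqP => v0; move: h; rewrite v0 /near1 /near2 /dot /=.
by rewrite !mulr0 !addr0 eq_sym oner_eq0.
Qed.

Lemma vscale_inj1 (l l' : R) v w : l != 0 -> v.1.1 = 1 -> w.1.1 = 1 ->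
  vscale l v = vscale l' w -> v = w.
Proof.
case: v w => [[v1 v2] v3] [[w1 w2] w3] /= l0 -> ->; rewrite /vscale /= !mulr1.
by case=> <- /(mulfI l0) -> /(mulfI l0) ->.
Qed.

Lemma vscale_inj2 (l l' : R) v w : l != 0 -> v.1.2 = 1 -> w.1.2 = 1 ->
  vscale l v = vscale l' w -> v = w.
Proof.
case: v w => [[v1 v2] v3] [[w1 w2] w3] /= l0 -> ->; rewrite /vscale /= !mulr1.
by case=> h1 h2 h3; move: h1 h3; rewrite -h2 => /(mulfI l0) -> /(mulfI l0) ->.
Qed.

(** * A grid of points and lines on the sphere *)

Section Construction.
Variables (k n : nat).
Hypotheses (k0 : (0 < k)%N) (kn : (3 * k ^ 3 <= n)%N).

Let d : R := (100 * n%:R)^-1.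

Let n0 : (0 < n)%N.
Proof. by apply: leq_trans kn; rewrite muln_gt0 /= expn_gt0 k0. Qed.

Let d0 : 0 < d.
Proof. by rewrite invr_gt0 mulr_gt0 // ltr0n. Qed.

Let small (i : nat) : (i <= n)%N ->
  (d ^+ 2 * i%:R) ^+ 2 <= 1 / 200 /\ (d * i%:R) ^+ 2 <= 1 / 200.
Proof.
move=> hi; have di : d * i%:R <= 1 / 100.
  have -> : 1 / 100 = d * n%:R :> R.
    by rewrite /d; field; rewrite pnatr_eq0 -lt0n n0.
  by rewrite ler_wpM2l ?ler_nat // ltW.
have d1 : d <= 1 / 100.
  rewrite /d mul1r lef_pV2 ?posrE // ?mulr_gt0 ?ltr0n //.
  by rewrite -[leLHS]mulr1 ler_wpM2l // ler1n.
have di0 : 0 <= d * i%:R by rewrite mulr_ge0 // ltW.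
have -> : d ^+ 2 * i%:R = d * (d * i%:R) by ring.
move: (d * i%:R) di di0 => c c1 c0; have := d0 => dd0.
have dc : 0 <= d * c <= 1 / 100 by apply/andP; split; nra.
by case/andP: dc => dc0 dc1; split; rewrite expr2; nra.
Qed.

Definition ptA (i : nat) : vec := normalize (dirA d (i %/ k)%:R (i %% k)%:R).
Definition ptB (i : nat) : vec := normalize (dirB d (i %/ k)%:R (i %% k)%:R).

Let le_div i : (i <= n)%N -> (i %/ k <= n)%N /\ (i %% k <= n)%N.
Proof.
by move=> hi; split; [exact: leq_trans (leq_div _ _) hi | exact: leq_trans (leq_mod _ _) hi].
Qed.

Lemma ptA_near i : (i <= n)%N -> near1 (ptA i).
Proof.
by move=> /le_div[h1 h2]; apply: dirA_near; [case: (small h1) | case: (small h2)].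
Qed.

Lemma ptB_near i : (i <= n)%N -> near2 (ptB i).
Proof.
by move=> /le_div[h1 h2]; apply: dirB_near; [case: (small h1) | case: (small h2)].
Qed.

Lemma ptA_inj i j : (i <= n)%N -> (j <= n)%N -> ptA i = ptA j -> i = j.
Proof.
move=> hi hj e.
have /andP[h _] : 1 <= dot (dirA d (i %/ k)%:R (i %% k)%:R)
    (dirA d (i %/ k)%:R (i %% k)%:R) <= 101 / 100.
  by case: (le_div hi) => h1 h2; apply: dirA_dot; [case: (small h1) | case: (small h2)].
have l0 : (Num.sqrt (dot (dirA d (i %/ k)%:R (i %% k)%:R)
    (dirA d (i %/ k)%:R (i %% k)%:R)))^-1 != 0.
  by rewrite invr_eq0 gt_eqF // sqrtr_gt0 (lt_le_trans ltr01).
have [e1 e2] := @vscale_inj1 _ _ (dirA d _ _) (dirA d _ _) l0 erefl erefl e.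
rewrite (divn_eq i k) (divn_eq j k).
have dn : d != 0 by rewrite gt_eqF.
by move: e1 e2 => /(mulfI (expf_neq0 2 dn))/eqP; rewrite eqr_nat => /eqP ->
  /(mulfI dn)/eqP; rewrite eqr_nat => /eqP ->.
Qed.

Lemma ptB_inj i j : (i <= n)%N -> (j <= n)%N -> ptB i = ptB j -> i = j.
Proof.
move=> hi hj e.
have /andP[h _] : 1 <= dot (dirB d (i %/ k)%:R (i %% k)%:R)
    (dirB d (i %/ k)%:R (i %% k)%:R) <= 101 / 100.
  by case: (le_div hi) => h1 h2; apply: dirB_dot; [case: (small h1) | case: (small h2)].
have l0 : (Num.sqrt (dot (dirB d (i %/ k)%:R (i %% k)%:R)
    (dirB d (i %/ k)%:R (i %% k)%:R)))^-1 != 0.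
  by rewrite invr_eq0 gt_eqF // sqrtr_gt0 (lt_le_trans ltr01).
have [e1 e2] := @vscale_inj2 _ _ (dirB d _ _) (dirB d _ _) l0 erefl erefl e.
rewrite (divn_eq i k) (divn_eq j k).
have dn : d != 0 by rewrite gt_eqF.
by move: e1 e2 => /oppr_inj/(mulfI (expf_neq0 2 dn))/eqP; rewrite eqr_nat => /eqP ->
  /oppr_inj/(mulfI dn)/eqP; rewrite eqr_nat => /eqP ->.
Qed.

(** The lines take [k ^ 3] vectors; the rest is filled with grid points up to size [n], more of them
    than the incidences may use. *)
Definition pts : seq vec :=
  (0, 0, 0) :: [seq ptA i | i <- iota 0 (n - (k ^ 3).+1)] ++ [seq ptB i | i <- iota 0 (k ^ 3)].

Let k3n : (k ^ 3 < n)%N.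
Proof.
apply: leq_trans kn; have : (0 < k ^ 3)%N by rewrite expn_gt0 k0.
by lia.
Qed.

Let leA i : i \in iota 0 (n - (k ^ 3).+1) -> (i <= n)%N.
Proof. by rewrite mem_iota /=; lia. Qed.

Let leB i : i \in iota 0 (k ^ 3) -> (i <= n)%N.
Proof. by rewrite mem_iota /=; have := k3n; lia. Qed.

Lemma pts_cluster v : v \in pts -> cluster v.
Proof.
rewrite inE mem_cat => /or3P[/eqP->|/mapP[i /leA/ptA_near h ->]|/mapP[i /leB/ptB_near h ->]];
  by rewrite /cluster ?eqxx // h ?orbT.
Qed.

Lemma uniq_pts : uniq pts.
Proof.
rewrite /= mem_cat negb_or cat_uniq !map_inj_in_uniq ?iota_uniq /=; last 2 first.
- by move=> i j /leB hi /leB hj; exact: ptB_inj.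
- by move=> i j /leA hi /leA hj; exact: ptA_inj.
rewrite andbT -andbA; apply/and3P; split.
- apply/negP => /mapP[i /leA/ptA_near h e].
  by have := near_neq0 (v := ptA i); rewrite h -e eqxx => /(_ isT).
- apply/negP => /mapP[i /leB/ptB_near h e].
  by have := near_neq0 (v := ptB i); rewrite h orbT -e eqxx => /(_ isT).
- apply/hasPn => v /mapP[i /leB/ptB_near hB ->]; apply/negP => /mapP[j /leA/ptA_near hA e].
  by have := near12_neq hA hB; rewrite e eqxx.
Qed.

Lemma size_pts : size pts = n.
Proof. by rewrite /= size_cat !size_map !size_iota; have := k3n; lia. Qed.

Definition ptset : {fset 'rV[R]_3} := [fset p in map tor pts].

Lemma tor_inj : injective (@tor).
Proof. exact: can_inj torK. Qed.

Lemma card_ptset : #|` ptset| = n.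
Proof.
rewrite /ptset card_fseq undup_id ?size_map ?size_pts //.
by rewrite map_inj_uniq ?uniq_pts //; exact: tor_inj.
Qed.

Lemma mem_ptset (p : 'rV[R]_3) : (p \in ptset) = (p \in map tor pts).
Proof. by apply/imfsetP/idP => [[x xs ->] //|ps]; exists p. Qed.

Lemma ptset_area a b c : a \in ptset -> b \in ptset -> c \in ptset -> area a b c <= 1 / 2.
Proof.
rewrite !mem_ptset => /mapP[p /pts_cluster pp ->] /mapP[q /pts_cluster pq ->].
move=> /mapP[r /pts_cluster pr ->]; rewrite areaE !tovB.
have h := cluster_nn pp pq pr.
have : Num.sqrt (nn (vsub q p) (vsub r p)) <= 1 by rewrite -sqrtr1 ler_wsqrtr.
by lra.
Qed.

(** The code of the grid point with abscissa [z.2] on the line coded by [z.1]: its ordinate is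
    intercept plus slope times abscissa. *)
Definition idxA (z : nat * nat) := ((z.1 %/ k + z.1 %% k * z.2) * k + z.2)%N.
Definition tri (z : nat * nat) : {fset 'rV[R]_3} :=
  [fset tor (0, 0, 0); tor (ptA (idxA z)); tor (ptB z.1)].

(** Ordinates stay below [2 k^2], so the grid needs at most [2 k^3] indices; the lines add [k^3],
    whence the factor 3 in [kn]. Room for the origin is left by [(k - 1)^2] in place of [k^2]. *)
Lemma idxA_bound z : (z.1 < k ^ 3)%N -> (z.2 < k)%N -> (idxA z < n - (k ^ 3).+1)%N.
Proof.
case: z => j y /= hj hy; rewrite /idxA /=.
have hc : (j %/ k < k ^ 2)%N by rewrite ltn_divLR // -expnSr.
have hm : (j %% k < k)%N by rewrite ltn_mod.
move: (j %/ k)%N (j %% k)%N hc hm => c m hc hm.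
have hmy : (m * y <= (k.-1) * (k.-1))%N by apply: leq_mul; lia.
have : ((c + m * y) * k + y <= ((k ^ 2).-1 + k.-1 * k.-1) * k + k.-1)%N.
  by apply: leq_add; [rewrite leq_mul2r leq_add ?orbT //; lia | lia].
move: kn k0; case: (k) => // k' h _; rewrite /= !expnS expn0 in h *; nia.
Qed.

Lemma tri_max z : (z.1 < k ^ 3)%N -> (z.2 < k)%N -> tri z \in max_area_triangles ptset.
Proof.
move=> h1 h2; have hi := idxA_bound h1 h2.
have iA : idxA z \in iota 0 (n - (k ^ 3).+1) by rewrite mem_iota.
have iB : z.1 \in iota 0 (k ^ 3) by rewrite mem_iota.
have m0 : tor (0, 0, 0) \in ptset by rewrite mem_ptset map_f // mem_head.
have mA : tor (ptA (idxA z)) \in ptset.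
  by rewrite mem_ptset map_f // inE mem_cat map_f ?orbT.
have mB : tor (ptB z.1) \in ptset.
  by rewrite mem_ptset map_f // inE mem_cat (map_f ptB) ?orbT.
have nA := ptA_near (leA iA); have nB := ptB_near (leB iB).
have vz v : vsub v (0, 0, 0) = v by case: v => [[v1 v2] v3]; rewrite /vsub /= !subr0.
have orth : dot (ptA (idxA z)) (ptB z.1) = 0.
  rewrite dot_normalize (_ : dot (dirA _ _ _) (dirB _ _ _) = 0) ?mulr0 //.
  rewrite /idxA divnMDl // modnMDl.
  rewrite (divn_small h2) (modn_small h2) addn0 natrD natrM /dot /dirA /dirB /=.
  by ring.
have nn1 : nn (ptA (idxA z)) (ptB z.1) = 1.
  have -> x y : nn x y = dot x x * dot y y - dot x y ^+ 2.
    by rewrite /nn /dot /cross /=; ring.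
  have /andP[/eqP -> _] := nA; have /andP[/eqP -> _] := nB.
  by rewrite orth expr0n mulr1 subr0.
have [Tt Ta] : tri z \in triangles ptset /\ tri_area (tri z) =
    area (tor (0, 0, 0)) (tor (ptA (idxA z))) (tor (ptB z.1)).
  by apply: triangles3 => //; rewrite !tovB !vz nn1 oner_eq0.
rewrite inE /=; apply/andP; split=> //; apply/asboolP => T' T't.
have [a [b [c [eT [aP bP cP] _]]]] := trianglesP T't.
rewrite Ta areaE !tovB !vz nn1 sqrtr1 /tri_area eT /=.
exact: ptset_area.
Qed.

Lemma tri_inj z z' : (z.1 < k ^ 3)%N -> (z.2 < k)%N -> (z'.1 < k ^ 3)%N -> (z'.2 < k)%N ->
  tri z = tri z' -> z = z'.
Proof.
move=> h1 h2 h1' h2' e.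
have iA : idxA z \in iota 0 (n - (k ^ 3).+1) by rewrite mem_iota idxA_bound.
have iB : z.1 \in iota 0 (k ^ 3) by rewrite mem_iota.
have iA' : idxA z' \in iota 0 (n - (k ^ 3).+1) by rewrite mem_iota idxA_bound.
have iB' : z'.1 \in iota 0 (k ^ 3) by rewrite mem_iota.
have nA := ptA_near (leA iA); have nB := ptB_near (leB iB).
have nA' := ptA_near (leA iA'); have nB' := ptB_near (leB iB').
have eB : z.1 = z'.1.
  have : tor (ptB z.1) \in tri z' by rewrite -e !inE eqxx !orbT.
  rewrite !inE !(inj_eq tor_inj) => /orP[/orP[]|]/eqP h.
  - by have := near_neq0 (v := ptB z.1); rewrite nB orbT h eqxx => /(_ isT).
  - by have := near12_neq nA' nB; rewrite h eqxx.
  - by apply: ptB_inj h; exact: leB.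
have eA : idxA z = idxA z'.
  have : tor (ptA (idxA z)) \in tri z' by rewrite -e !inE eqxx !orbT.
  rewrite !inE !(inj_eq tor_inj) => /orP[/orP[]|]/eqP h.
  - by have := near_neq0 (v := ptA (idxA z)); rewrite nA h eqxx => /(_ isT).
  - by apply: ptA_inj h; exact: leA.
  - by have := near12_neq nA nB'; rewrite h eqxx.
have : (idxA z %% k = idxA z' %% k)%N by rewrite eA.
rewrite /idxA !modnMDl !modn_small // => e2.
by case: z z' eB e2 {e h1 h2 h1' h2' iA iB iA' iB' nA nB nA' nB' eA} => z1 z2 [z1' z2'] /= -> ->.
Qed.

Lemma many_max_triangles : (k ^ 4 <= #|` max_area_triangles ptset|)%N.
Proof.
pose zs := [seq (j, i) | j <- iota 0 (k ^ 3), i <- iota 0 k].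
have -> : (k ^ 4)%N = size (map tri zs).
  by rewrite size_map size_allpairs !size_iota -expnSr.
have zsE z : z \in zs -> (z.1 < k ^ 3)%N /\ (z.2 < k)%N.
  by move=> /allpairsP[[j y] /= [hj hy ->]]; move: hj hy; rewrite !mem_iota.
apply: uniq_leq_size.
  rewrite map_inj_in_uniq.
    by apply: allpairs_uniq; rewrite ?iota_uniq // => -[a b] [a' b'] _ _ [-> ->].
  by move=> z z' /zsE[h1 h2] /zsE[h1' h2']; exact: tri_inj.
by move=> T /mapP[z /zsE[h1 h2] ->]; exact: tri_max.
Qed.

End Construction.

Lemma max_area_lower : exists2 c : R, 0 < c &
  forall n : nat, (3 <= n)%N -> exists2 P : {fset 'rV[R]_3}, #|` P| = n &
    c * n%:R `^ (4 / 3) <= #|` max_area_triangles P|%:R.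
Proof.
(* For the largest admissible [k], [n < 3 (k + 1)^3 <= 24 k^3 <= (3 k)^3], so
   [n^(4/3) <= 81 k^4]. *)
exists (1 / 81); first by lra.
move=> n n3.
have ex : exists k, (3 * k ^ 3 <= n)%N by exists 1%N.
have bd k : (3 * k ^ 3 <= n)%N -> (k <= n)%N.
  move=> h; apply: leq_trans h; case: k => // k.
  by rewrite !expnS expn0; nia.
case: (ex_maxnP ex bd) => k kn kmax.
have k0 : (0 < k)%N by apply: kmax.
have lt : (n < 3 * k.+1 ^ 3)%N by rewrite ltnNge; apply/negP => /kmax; rewrite ltnn.
exists (ptset k n); first exact: card_ptset.
apply: (@le_trans _ _ (k ^ 4)%:R); last by rewrite ler_nat many_max_triangles.
have n27 : (n <= (3 * k) ^ 3)%N.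
  apply: leq_trans (ltnW lt) _; case: k k0 {kn kmax lt} => // k _.
  by rewrite !expnS expn0; nia.
have : n%:R `^ (4 / 3) <= ((3 * k) ^ 4)%:R :> R.
  apply: (@le_trans _ _ (((3 * k) ^ 3)%:R `^ (4 / 3))).
    by rewrite ler_natpow //; lra.
  rewrite !natrX -!powR_mulrn // -powRrM.
  by rewrite (_ : 3%:R * (4 / 3) = 4%:R) //; field.
by rewrite expnMn natrM; lra.
Qed.

End Lower.

Theorem theorem11 (R : realType) :
  (forall eps : R, 0 < eps ->
     exists C : R, forall (n : nat) (P : {fset 'rV[R]_3}),
       #|` P| = n ->
       #|` max_area_triangles P|%:R <= C * n%:R `^ (7 / 3 + eps)) /\
  (exists2 c : R, 0 < c &
     forall n : nat, (3 <= n)%N ->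
       exists2 P : {fset 'rV[R]_3}, #|` P| = n &
         c * n%:R `^ (4 / 3) <= #|` max_area_triangles P|%:R).
Proof. by split; [exact: max_area_upper | exact: max_area_lower]. Qed.
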